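(* Let $P\subset\mathbb{R}^d$ be a full-dimensional polytope such that some inscribed polytope has the same normal fan $\mathcal{F}$ as $P$. Then the following are equivalent: (i) $P$ is even, i.e. every $2$-face of $P$ has an even number of vertices; (ii) $\dim\mathrm{InCone}(P)=d$; (iii) $\mathrm{InSpc}(\mathcal{F},R_0)=\mathbb{R}^d$ for any region $R_0$ of $\mathcal{F}$.
   Context: $\mathrm{InCone}(P)$ is the set of polytopes with all vertices on a common sphere and normal fan $\mathcal{F}$, modulo translation (a polyhedral cone). The dual graph of $\mathcal{F}$ has the regions (full-dimensional cones) as nodes, with $R,R'$ adjacent if $R\cap R'$ is $(d-1)$-dimensional; $s_{RR'}$ is the reflection in the linear span of $R\cap R'$, and for a walk $\mathcal{W}=R_0R_1\cdots R_k$, $t_{\mathcal{W}}=s_{R_kR_{k-1}}\cdots s_{R_1R_0}$. The based inscribed space $\mathrm{InSpc}(\mathcal{F},R_0)$ is the set of $v\in\mathbb{R}^d$ (orthogonal to the lineality space, here $\{0\}$) with $t_{\mathcal{W}}(v)=v$ for all closed walks $\mathcal{W}$ starting at $R_0$. *)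

(* Defs.v *)
From mathcomp Require Import all_boot all_order all_algebra.
From Stdlib Require Import ClassicalEpsilon.
Set Implicit Arguments. Unset Strict Implicit. Unset Printing Implicit Defensive.
Import Order.TTheory GRing.Theory Num.Theory.
Local Open Scope ring_scope.

Section Defs.
Variable R : realFieldType.
Variable d : nat.
Notation vec := 'rV[R]_d.

Definition dot (u v : vec) : R := \sum_(i < d) u 0 i * v 0 i.

(* dimension of the linear span of an (arbitrary) subset of a finite-dim space:
   the maximal size of a linearly independent family drawn from it *)
Definition dimset (vT : vectType R) (S : vT -> Prop) (k : nat) : Prop :=
  (exists X : seq vT, (forall x, x \in X -> S x) /\ free X /\ size X = k) /\
  (forall X : seq vT, (forall x, x \in X -> S x) -> free X -> (size X <= k)%N).

Definition conv n (V : 'M[R]_(n, d)) (x : vec) : Prop :=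
  exists l : 'I_n -> R, (forall i, 0 <= l i) /\ \sum_i l i = 1 /\
    x = \sum_i l i *: row i V.

Definition affdim (S : vec -> Prop) (k : nat) : Prop :=
  dimset (fun u : vec => exists x y, S x /\ S y /\ u = x - y) k.

Definition full_dim n (V : 'M[R]_(n, d)) : Prop := affdim (conv V) d.

Definition extreme (S : vec -> Prop) (x : vec) : Prop :=
  S x /\ forall y z (t : R), S y -> S z -> 0 < t < 1 ->
    x = t *: y + (1 - t) *: z -> y = z.

Definition NC n (V : 'M[R]_(n, d)) (x : vec) (c : vec) : Prop :=
  forall y, conv V y -> dot c y <= dot c x.

Definition face n (V : 'M[R]_(n, d)) (c : vec) (x : vec) : Prop :=
  conv V x /\ NC V x c.

Definition fan n (V : 'M[R]_(n, d)) (C : vec -> Prop) : Prop :=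
  exists x, conv V x /\ forall c, C c <-> NC V x c.

Definition same_fan n m (V : 'M[R]_(n, d)) (W : 'M[R]_(m, d)) : Prop :=
  forall C, fan V C <-> fan W C.

Definition region n (V : 'M[R]_(n, d)) (C : vec -> Prop) : Prop :=
  fan V C /\ dimset C d.

Definition inscribed n (V : 'M[R]_(n, d)) : Prop :=
  exists (z : vec) (rho : R), forall w, extreme (conv V) w -> dot (w - z) (w - z) = rho.

Definition even_polytope n (V : 'M[R]_(n, d)) : Prop :=
  forall c, affdim (face V c) 2 ->
    forall s : seq vec, uniq s -> (forall x, x \in s <-> extreme (face V c) x) ->
      ~~ odd (size s).

(* InCone(P), embedded linearly: a polytope Q with the normal fan of P is
   recorded by the matrix whose i-th row is the vertex of Q whose normal cone
   is the normal cone of P at its vertex row i V. *)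
Definition InCone_mx n (V : 'M[R]_(n, d)) (M : 'M[R]_(n, d)) : Prop :=
  inscribed M /\ same_fan V M /\
  forall i, forall c, NC M (row i M) c <-> NC V (row i V) c.

Definition transl_mx n (M : 'M[R]_(n, d)) : Prop :=
  exists t : vec, forall i, row i M = t.

(* dimension of InCone(P) modulo translation *)
Definition dim_InCone n (V : 'M[R]_(n, d)) (k : nat) : Prop :=
  exists a b, dimset (fun M => InCone_mx V M \/ transl_mx M) a /\
              dimset (@transl_mx n) b /\ (a - b)%N = k.

Definition adjacent n (V : 'M[R]_(n, d)) (C C' : vec -> Prop) : Prop :=
  region V C /\ region V C' /\ dimset (fun c => C c /\ C' c) d.-1.

(* reflection in the linear span of a set S spanning a hyperplane:
   v |-> v - 2 <v,u>/<u,u> u for a (chosen) nonzero normal u of S *)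
Definition refl (S : vec -> Prop) (v : vec) : vec :=
  let u := epsilon (inhabits (0 : vec))
             (fun u => u != 0 /\ forall x, S x -> dot u x = 0) in
  v - ((2 * dot v u) / dot u u) *: u.

Fixpoint is_walk n (V : 'M[R]_(n, d)) (C : vec -> Prop) (w : seq (vec -> Prop)) : Prop :=
  match w with
  | [::] => True
  | C' :: w' => adjacent V C C' /\ is_walk V C' w'
  end.

Fixpoint tW (C : vec -> Prop) (w : seq (vec -> Prop)) (v : vec) : vec :=
  match w with
  | [::] => v
  | C' :: w' => tW C' w' (refl (fun c => C c /\ C' c) v)
  end.

(* based inscribed space (lineality space is {0} for full-dim P) *)
Definition InSpc n (V : 'M[R]_(n, d)) (C0 : vec -> Prop) (v : vec) : Prop :=
  forall w, is_walk V C0 w -> (forall c, last C0 w c <-> C0 c) -> tW C0 w v = v.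

End Defs.

(* Main.v *)
Require Import Defs.
From mathcomp Require Import all_boot all_order all_algebra.
From mathcomp Require Import ring lra.
From HB Require Import structures.
From Stdlib Require Import ClassicalEpsilon.
Set Implicit Arguments. Unset Strict Implicit. Unset Printing Implicit Defensive.
Import Order.TTheory GRing.Theory Num.Theory.
Local Open Scope ring_scope.

(** Edges of the polytope are the pairs of vertices whose normal cones meet in
    codimension one, and reflecting along the edges of a walk gives an
    orthogonal matrix; (iii) says that every closed walk gives the identity.

    (i) => (iii): fix a functional [l] injective on the vertices.  By induction
    from the top, all ascending walks from a vertex to the top give the same
    matrix: two ascending edges at [x] are linked by a chain of ascending edges
    in which neighbours share a 2-face (the simplex method in the vertex figure
    at [x]), and the two sides of such a 2-face give isometries which agree on
    the vertex of the inscribed polytope and, the 2-face being even, have the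
    same orientation on its plane.  Hence closed walks are trivial.

    (iii) => (i): the two sides of a 2-face must have the same orientation.

    (ii) <=> (iii): an inscribed polytope with the given fan is determined by its
    center and one vertex, which is fixed by all closed walks; conversely, when
    there is no monodromy, all positions of that vertex in a neighbourhood of a
    given one are realized, since positivity of the edge lengths is an open
    condition that forces the normal fan. *)

(** * The dot product and systems of strict inequalities *)

(** A generic height replaces any appeal to simple connectivity of the dual complex. Confluence of
    ascending walks, reduced at each vertex to its 2-faces, yields a matrix potential on the
    vertices, and a potential has no monodromy. The given inscribed polytope is needed because its
    vertices, seen from the center, are carried to each other by the edge reflections. This pins one
    vector, so that around a 2-face only the orientation, hence the parity of the number of
    reflections, remains free. The ground field is merely ordered: limits and compactness give way
    to small steps that respect finitely many strict inequalities, and lengths occur only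
    squared. *)

Section Dot.
Variables (R : realFieldType) (d : nat).
Implicit Types u v w x y c q : 'rV[R]_d.

Lemma dotC u v : dot u v = dot v u.
Proof. by apply: eq_bigr => i _; rewrite mulrC. Qed.

Lemma dotDl u v w : dot (u + v) w = dot u w + dot v w.
Proof. by rewrite -big_split; apply: eq_bigr => i _; rewrite mxE mulrDl. Qed.

Lemma dotZl a u w : dot (a *: u) w = a * dot u w.
Proof. by rewrite mulr_sumr; apply: eq_bigr => i _; rewrite mxE mulrA. Qed.

Lemma dotDr u v w : dot w (u + v) = dot w u + dot w v.
Proof. by rewrite dotC dotDl !(dotC w). Qed.

Lemma dotZr a u w : dot w (a *: u) = a * dot w u.
Proof. by rewrite dotC dotZl (dotC w). Qed.

Lemma dotNl u w : dot (- u) w = - dot u w.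
Proof. by rewrite -scaleN1r dotZl mulN1r. Qed.

Lemma dotNr u w : dot w (- u) = - dot w u.
Proof. by rewrite dotC dotNl dotC. Qed.

Lemma dotBl u v w : dot (u - v) w = dot u w - dot v w.
Proof. by rewrite dotDl dotNl. Qed.

Lemma dotBr u v w : dot w (u - v) = dot w u - dot w v.
Proof. by rewrite dotDr dotNr. Qed.

Lemma dot0l w : dot 0 w = 0.
Proof. by rewrite -(scale0r 0) dotZl mul0r. Qed.

Lemma dot0r w : dot w 0 = 0.
Proof. by rewrite dotC dot0l. Qed.

Definition dotE :=
  (dotDl, dotDr, dotZl, dotZr, dotNl, dotNr, dot0l, dot0r).

Lemma dot_sumr I (r : seq I) (P : pred I) (F : I -> 'rV[R]_d) w :
  dot w (\sum_(i <- r | P i) F i) = \sum_(i <- r | P i) dot w (F i).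
Proof.
by apply: (big_morph (dot w)); [move=> ? ?; rewrite dotDr | rewrite dot0r].
Qed.

Lemma dot_ge0 u : 0 <= dot u u.
Proof. by apply: sumr_ge0 => i _; rewrite -expr2 sqr_ge0. Qed.

Lemma dot_eq0 u : (dot u u == 0) = (u == 0).
Proof.
apply/idP/eqP => [|->]; last by rewrite dot0l.
rewrite psumr_eq0 => [/allP h|i _]; last by rewrite -expr2 sqr_ge0.
apply/rowP => i; rewrite mxE; apply/eqP.
by have := h i (mem_index_enum i); rewrite /= mulf_eq0 orbb.
Qed.

Lemma dot_gt0 u : u != 0 -> 0 < dot u u.
Proof. by move=> u0; rewrite lt_neqAle dot_ge0 andbT eq_sym dot_eq0. Qed.

(** The substitute for continuity: every openness argument below is an instance of it. *)
Lemma small_pos (T : eqType) (s : seq T) (a b : T -> R) :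
  (forall t, t \in s -> 0 < a t) ->
  exists2 e, 0 < e & forall t, t \in s -> 0 < a t + e * b t.
Proof.
move=> ha.
(* The induction shrinks the step, so the bound must hold on all of [[0, e]]. *)
suff [e e0 he] : exists2 e, 0 < e & forall f, 0 <= f -> f <= e ->
    forall t, t \in s -> 0 < a t + f * b t.
  by exists e => // t ts; apply: (he e); rewrite ?lexx ?ltW.
elim: s ha => [|t s ih] ha; first by exists 1; rewrite ?ltr01.
have [|e e0 he] := ih; first by move=> z zs; apply: ha; rewrite inE zs orbT.
have at0 : 0 < a t by apply: ha; rewrite inE eqxx.
have D : 0 < `|b t| + 1 by apply: ltr_wpDl.
(* The [+ 1] keeps the denominator positive, the [/ 2] keeps the inequality strict. *)
exists (Num.min e (a t / (`|b t| + 1) / 2)).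
  by rewrite lt_min e0 /= !divr_gt0.
move=> f f0; rewrite le_min => /andP[fe fa] z; rewrite inE => /orP[/eqP ->|zs];
  last exact: he.
have h1 : f * (`|b t| + 1) <= a t / 2.
  by rewrite -ler_pdivlMr // mulrAC.
have h2 : - `|b t| <= b t by rewrite lerNl -normrN ler_norm.
have h3 : f * - `|b t| <= f * b t by apply: ler_wpM2l.
by lra.
Qed.

(* For [q = 0] the division by zero makes this projection the identity. *)
Definition rej q u : 'rV[R]_d := locked (u - (dot u q / dot q q) *: q).

Lemma rej_orth q u : dot (rej q u) q = 0.
Proof.
rewrite /rej -lock !dotE; have [->|q0] := eqVneq q 0; first by rewrite !dot0r mulr0 subr0.
by rewrite divfK ?subrr // dot_eq0.
Qed.

Lemma dot_rej q u : dot u (rej q u) = dot (rej q u) (rej q u).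
Proof.
have h := rej_orth q u.
by rewrite {3}/rej -lock [in RHS]dotBr dotZr h mulr0 subr0 dotC.
Qed.

Lemma rej_neq0 q u : (forall k, u <> k *: q) -> rej q u != 0.
Proof. by move=> h; apply/eqP => /eqP; rewrite /rej -lock subr_eq0 => /eqP /h. Qed.


(** General position inside the hyperplane orthogonal to [q]: since [u] is no multiple of [q], its
    part orthogonal to [q] is a direction in that hyperplane along which [dot _ u] changes. Taking
    [q = 0] gives an unconstrained perturbation. *)
Lemma generic_perturb q c (A U : seq 'rV[R]_d) :
  dot c q = 0 -> (forall a, a \in A -> 0 < dot c a) ->
  (forall u k, u \in U -> u <> k *: q) ->
  exists c', [/\ dot c' q = 0, forall a, a \in A -> 0 < dot c' a
    & forall u, u \in U -> dot c' u != 0].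
Proof.
elim: U A => [|u U ih] A cq cA hU; first by exists c.
have [k|c1 [c1q c1A c1U]] := ih A cq cA.
  by move=> k' kU; apply: hU; rewrite inE kU orbT.
have [z|nz] := eqVneq (dot c1 u) 0; last first.
  by exists c1; split=> // v; rewrite inE => /orP[/eqP->|/c1U].
have u'0 : rej q u != 0 by apply: rej_neq0 => k'; apply: hU; rewrite inE eqxx.
(* Up to sign, the nonvanishing conditions already achieved are positivity conditions, so a small
   step preserves them. *)
pose W := A ++ [seq (Num.sg (dot c1 v)) *: v | v <- U].
have hW : forall a, a \in W -> 0 < dot c1 a.
  move=> a; rewrite mem_cat => /orP[/c1A //|/mapP[v vU ->]].
  by rewrite dotZr -normrEsg normr_gt0 c1U.
have [e e0 he] := small_pos (fun a => dot (rej q u) a) hW.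
exists (c1 + e *: rej q u); split.
- by rewrite !dotE c1q rej_orth mulr0 addr0.
- move=> a aA; rewrite !dotE; apply: (he a).
  by rewrite mem_cat aA.
move=> v; rewrite inE => /orP[/eqP ->|vU].
  rewrite !dotE z add0r (dotC _ u) dot_rej mulf_neq0 ?gt_eqF //.
  by rewrite dot_gt0.
have := he (Num.sg (dot c1 v) *: v); rewrite !dotE mem_cat.
rewrite (map_f (fun v => Num.sg (dot c1 v) *: v)) ?orbT // => /(_ isT).
rewrite mulrCA -mulrDr => h; apply: contraTneq h => ->; by rewrite mulr0 ltxx.
Qed.

(** Gordan's theorem of the alternative, by eliminating the head of the list. Coefficients are
    indexed by [nat] so that shifting them in the induction needs no casts. *)
Lemma gordan (s : seq 'rV[R]_d) :
  (exists c, forall a, a \in s -> 0 < dot c a) \/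
  (exists l : nat -> R, [/\ forall i, 0 <= l i,
      exists2 i, (i < size s)%N & 0 < l i
    & \sum_(i < size s) l i *: s`_i = 0]).
Proof.
have [m] := ubnP (size s); elim: m s => // m ih [|a s] hs.
  by left; exists 0.
have single : a = 0 -> exists l : nat -> R, [/\ forall i, 0 <= l i,
      exists2 i, (i < size (a :: s))%N & 0 < l i
    & \sum_(i < size (a :: s)) l i *: (a :: s)`_i = 0].
  move=> ->; exists (fun i => (i == 0%N)%:R); split.
  - by move=> i; rewrite ler0n.
  - by exists 0%N => //; rewrite eqxx ltr01.
  by rewrite big_ord_recl /= scaler0 add0r big1 // => i _; rewrite scale0r.
have [[c hc]|[l [l0 [i hi li] sl]]] := ih s hs; last first.
  right; exists (fun i => if i is j.+1 then l j else 0); split.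
  - by case.
  - by exists i.+1.
  by rewrite big_ord_recl scale0r add0r.
have [pos|neg|z] := ltrgtP 0 (dot c a).
- by left; exists c => v; rewrite inE => /orP[/eqP ->|/hc].
(* The positive [mu v] makes [v + mu v *: a] orthogonal to [c], which eliminates [a]. *)
- pose mu v := - (dot c v / dot c a).
  have mu0 v : v \in s -> 0 < mu v.
    by move=> vs; rewrite /mu -mulrN -invrN divr_gt0 ?hc // oppr_gt0.
  pose s' := [seq v + mu v *: a | v <- s].
  have ss' : size s' = size s by rewrite size_map.
  have [|[c' hc']|[l [l0 [i hi li] sl]]] := ih s'; first by rewrite ss'.
  + have z v : v \in s -> dot c (v + mu v *: a) = 0.
      move=> vs; rewrite !dotE /mu mulNr divfK ?subrr //.
      by rewrite lt_eqF.
    have [e e0 he] := small_pos (s := s) (a := fun v => dot c' (v + mu v *: a))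
       (fun v => - mu v) (fun v vs => hc' _ (map_f (fun v => v + mu v *: a) vs)).
    (* Adding a multiple of [c] does not affect the values on [s'], and this multiple sets the value
       at [a] to the small positive [e]. *)
    left; exists (c' + ((e - dot c' a) / dot c a) *: c) => v.
    have da : dot (c' + ((e - dot c' a) / dot c a) *: c) a = e.
      by rewrite !dotE divfK ?lt_eqF //; lra.
    rewrite inE => /orP[/eqP ->|vs]; first by rewrite da.
    have := he v vs.
    have -> : dot c' (v + mu v *: a) =
      dot (c' + ((e - dot c' a) / dot c a) *: c) (v + mu v *: a).
      by rewrite [in RHS]dotDl dotZl z // mulr0 addr0.
    by rewrite dotDr dotZr da; lra.
  right; rewrite ss' in hi sl.
  exists (fun k => if k is j.+1 then l j else \sum_(j < size s) l j * mu s`_j); split.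
  - case=> // ; apply: sumr_ge0 => j _; rewrite mulr_ge0 // ltW // mu0 //.
    exact: mem_nth.
  - by exists i.+1.
  rewrite big_ord_recl /= scaler_suml -big_split; apply: etrans sl.
  apply: eq_bigr => j _; rewrite (nth_map 0) // scalerDr scalerA addrC.
  by [].
- have [/single|a0] := eqVneq a 0; first by right.
  have [e e0 he] := small_pos (fun v => dot a v) hc.
  left; exists (c + e *: a) => v; rewrite inE => /orP[/eqP ->|vs].
    by rewrite !dotE -z add0r mulr_gt0 // dot_gt0.
  by rewrite !dotE he.
Qed.

(* Pushing [c] in the direction [g] until the first constraint becomes tight. *)
Lemma ratio_test (A : seq 'rV[R]_d) c g :
  (forall r, r \in A -> dot c r < 0 \/ dot c r = 0 /\ dot g r = 0) ->
  (exists2 r, r \in A & 0 < dot g r) ->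
  exists t, 0 < t /\ (forall r, r \in A -> dot (c + t *: g) r <= 0) /\
    (exists2 r, r \in A & 0 < dot g r /\ dot (c + t *: g) r = 0).
Proof.
elim: A => [|a A ih] hA [r0]; first by [].
have hA' r : r \in A -> dot c r < 0 \/ dot c r = 0 /\ dot g r = 0.
  by move=> rA; apply: hA; rewrite inE rA orbT.
have ha : dot c a < 0 \/ dot c a = 0 /\ dot g a = 0.
  by apply: hA; rewrite inE eqxx.
have base : (forall r, r \in A -> ~~ (0 < dot g r)) -> 0 < dot g a ->
  exists t, 0 < t /\ (forall r, r \in a :: A -> dot (c + t *: g) r <= 0) /\
    (exists2 r, r \in a :: A & 0 < dot g r /\ dot (c + t *: g) r = 0).
  move=> hn ga; case: ha => [ca|[_ ga0]]; last by rewrite ga0 ltxx in ga.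
  have t0 : 0 < - (dot c a / dot g a).
    by rewrite -mulNr divr_gt0 // oppr_gt0.
  have za : dot (c + (- (dot c a / dot g a)) *: g) a = 0.
    by rewrite !dotE mulNr divfK ?subrr // gt_eqF.
  exists (- (dot c a / dot g a)); split => //; split; last first.
    by exists a; rewrite ?inE ?eqxx.
  move=> r; rewrite inE => /orP[/eqP ->|rA]; first by rewrite za.
  rewrite !dotE.
  have := hn r rA; rewrite -leNgt => gr.
  have : (- (dot c a / dot g a)) * dot g r <= 0 by rewrite pmulr_rle0.
  by case: (hA' r rA) => [|[-> ->]]; lra.
have [/hasP[r rA gr] _ _|/hasPn nh] := boolP (has (fun r => 0 < dot g r) A);
  last first.
  rewrite inE => /orP[/eqP ->|r0A gr0]; first exact: base.
  by have := nh _ r0A; rewrite gr0.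
have [|t [t0 [ht [r1 r1A [gr1 cr1]]]]] := ih hA'; first by exists r.
have [le|gt] := leP (dot (c + t *: g) a) 0.
  exists t; split => //; split; last by exists r1; rewrite ?inE ?r1A ?orbT.
  by move=> v; rewrite inE => /orP[/eqP ->|/ht].
have ga : 0 < dot g a.
  move: gt; rewrite !dotE; case: ha => [|[-> ->]]; last by lra.
  by move=> h1 h2; rewrite -(pmulr_rgt0 _ t0); lra.
case: ha => [ca|[_ z]]; last by rewrite z ltxx in ga.
have t0' : 0 < - (dot c a / dot g a) by rewrite -mulNr divr_gt0 // oppr_gt0.
have za : dot (c + (- (dot c a / dot g a)) *: g) a = 0.
  by rewrite !dotE mulNr divfK ?subrr // gt_eqF.
have lt : - (dot c a / dot g a) < t.
  move: gt; rewrite -{1}za !dotE ltrD2l ltr_pM2r //.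
exists (- (dot c a / dot g a)); split => //; split; last by exists a; rewrite ?inE ?eqxx.
move=> v; rewrite inE => /orP[/eqP ->|vA]; first by rewrite za.
have hv := ht v vA; move: hv; rewrite !dotE.
have [gv|gv] := leP (dot g v) 0.
  have : (- (dot c a / dot g a)) * dot g v <= 0 by rewrite pmulr_rle0.
  by case: (hA' v vA) => [|[-> ->]]; lra.
have : (- (dot c a / dot g a)) * dot g v <= t * dot g v by rewrite ler_pM2r // ltW.
by lra.
Qed.

End Dot.

(** Lets edges, defined by an existential, form a boolean relation to which [path] applies. *)
Definition asb (P : Prop) : bool :=
  if excluded_middle_informative P then true else false.

Lemma asbP (P : Prop) : reflect P (asb P).
Proof. by rewrite /asb; case: excluded_middle_informative => h; constructor. Qed.

Section Signs.
Variable R : realFieldType.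

Lemma opposite_signs (a b p q : R) : p < 0 -> q < 0 -> a * p + b * q = 0 ->
  [\/ a < 0 /\ 0 < b, 0 < a /\ b < 0 | a = 0 /\ b = 0].
Proof.
move=> p0 q0 e; have [a0|a0|a0] := ltrgtP a 0.
- constructor 1; split=> //; have : 0 < a * p by rewrite nmulr_rgt0.
  by move=> h; have : b * q < 0; [lra | rewrite nmulr_llt0].
- constructor 2; split=> //; have : a * p < 0 by rewrite pmulr_rlt0.
  by move=> h; have : 0 < b * q; [lra | rewrite nmulr_lgt0].
constructor 3; split=> //; move: e; rewrite a0 mul0r add0r => /eqP.
by rewrite mulf_eq0 (lt_eqF q0) orbF => /eqP.
Qed.

(** Each equation says that two of [a], [b], [c] have opposite signs or both vanish, and three
    nonzero numbers cannot have pairwise opposite signs. *)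
Lemma opposite_signs3 (a b c p q r s t u : R) :
  p < 0 -> q < 0 -> r < 0 -> s < 0 -> t < 0 -> u < 0 ->
  b * p + c * q = 0 -> a * r + c * s = 0 -> a * t + b * u = 0 -> c = 0.
Proof.
move=> p0 q0 r0 s0 t0 u0 /(opposite_signs p0 q0) bc /(opposite_signs r0 s0) ac.
move/(opposite_signs t0 u0) => ab {p0 q0 r0 s0 t0 u0}.
by case: ab => -[? ?]; case: bc => -[? ?]; case: ac => -[? ?] //; lra.
Qed.

End Signs.

(** * Exposed edges and the simplex method *)

Section Config.
Variables (R : realFieldType) (d : nat) (X : seq 'rV[R]_d).
Implicit Types u v w x y z c q : 'rV[R]_d.

Definition exposes c x := forall z, z \in X -> z != x -> dot c z < dot c x.
Definition maxat c x := forall z, z \in X -> dot c z <= dot c x.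

Definition edge_exposes c x y := dot c x = dot c y /\
  forall z, z \in X -> z != x -> z != y -> dot c z < dot c x.

Definition edge x y : bool :=
  [&& x \in X, y \in X, x != y & asb (exists c, edge_exposes c x y)].

Lemma edgeP x y : reflect
  [/\ x \in X, y \in X, x != y & exists c, edge_exposes c x y] (edge x y).
Proof. by apply: (iffP and4P) => -[? ? ? /asbP ?]; split=> //; apply/asbP. Qed.

Lemma edgeX x y : edge x y -> (x \in X) /\ (y \in X).
Proof. by case/edgeP. Qed.

Lemma edge_sym x y : edge x y -> edge y x.
Proof.
case/edgeP=> xX yX xy [c [e h]]; apply/edgeP; split=> //; first by rewrite eq_sym.
by exists c; split=> // z zX zy zx; rewrite -e h.
Qed.

Hypothesis Hexp : forall x, x \in X -> exists c, exposes c x.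

(** The functionals exposing [x] and [z] force [0 < t < 1]; then [y] lies strictly between them and
    cannot be exposed. *)
Lemma not_collinear x y z t : x \in X -> y \in X -> z \in X ->
  x != y -> y != z -> x != z -> y - x <> t *: (z - x).
Proof.
move=> xX yX zX xy yz xz e.
have [cx hx] := Hexp xX; have [cy hy] := Hexp yX; have [cz hz] := Hexp zX.
have [yx zy zx] : [/\ y != x, z != y & z != x] by split; rewrite eq_sym.
have D c : dot c y - dot c x = t * (dot c z - dot c x).
  by have := congr1 (dot c) e; rewrite !dotE.
have t0 : 0 < t.
  have := D cx; have := hx _ yX yx; have := hx _ zX zx => h1 h2 h3.
  by rewrite -(nmulr_llt0 _ (_ : dot cx z - dot cx x < 0)) ?subr_lt0 // -h3; lra.
have t1 : t < 1.
  have := D cz; have := hz _ yX yz; have := hz _ xX xz => h1 h2 h3.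
  have p : 0 < dot cz z - dot cz x by lra.
  by rewrite -(ltr_pM2r p) -h3; lra.
have := D cy; have := hy _ xX xy; have := hy _ zX zy => h1 h2 h3.
have : 0 < t * (dot cy z - dot cy x) by lra.
rewrite pmulr_rgt0 // => h4.
have : t * (dot cy z - dot cy x) < 1 * (dot cy z - dot cy x) by rewrite ltr_pM2r.
by lra.
Qed.

(** Tilt a functional exposing [x] towards [l] until another point first ties with [x]; for a
    generic start the tie is unique, so the tilted functional exposes an edge. *)
Lemma simplex x z l : x \in X -> z \in X -> dot l x < dot l z ->
  exists2 y, edge x y & dot l x < dot l y.
Proof.
move=> xX zX lxz; have [c0 hc0] := Hexp xX.
pose Y := [seq y <- X | y != x].
(* If [a] and [b] tie with [x] under [c + t *: l], then [c] vanishes on this combination, from which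
   [l] has been eliminated. The excluded zero combinations would make [x], [a], [b] collinear. *)
pose U := [seq p <- allpairs (fun a b => (dot l (b - x)) *: (a - x) -
   (dot l (a - x)) *: (b - x)) Y Y | p != 0].
have [] := @generic_perturb R d 0 c0 [seq x - y | y <- Y] U.
- by rewrite dot0r.
- move=> a /mapP[y]; rewrite mem_filter => /andP[yx yX] ->.
  by rewrite dotBr subr_gt0 hc0.
- move=> u k; rewrite mem_filter scaler0 => /andP[/eqP].
  by [].
move=> c [_ cY cU].
have [||t [t0 [ht [r rY [gr cr]]]]] :=
  @ratio_test R d [seq y - x | y <- Y] c l.
- move=> r /mapP[y yY ->]; left; have := cY (x - y) (map_f _ yY).
  by rewrite !dotE; lra.
- exists (z - x); last by rewrite !dotE subr_gt0.
  apply/mapP; exists z => //; rewrite mem_filter zX andbT.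
  by apply: contraTneq lxz => ->; rewrite ltxx.
case/mapP: rY gr cr => y yY -> gr cr.
have ly : dot l x < dot l y by move: gr; rewrite !dotE subr_gt0.
move: (yY); rewrite mem_filter => /andP[yx yX].
exists y => //; apply/edgeP; split=> //; first by rewrite eq_sym.
exists (c + t *: l); split; first by apply/eqP; rewrite -subr_eq0 -oppr_eq0 opprB -dotBr cr.
move=> w wX wx wy.
have wY : w \in Y by rewrite mem_filter wx.
have := ht (w - x) (map_f (fun w => w - x) wY); rewrite dotBr subr_le0 le_eqVlt.
case/orP=> [/eqP cw|//]; exfalso.
have cw' : dot (c + t *: l) (w - x) = 0 by rewrite dotBr cw subrr.
have lw : 0 < dot l (w - x).
  have := cY (x - w) (map_f _ wY); move: cw'; rewrite !dotE => h1 h2.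
  by rewrite -(pmulr_rgt0 _ t0); lra.
have ku : dot c ((dot l (w - x)) *: (y - x) - (dot l (y - x)) *: (w - x)) = 0.
  have -> : dot c ((dot l (w - x)) *: (y - x) - (dot l (y - x)) *: (w - x)) =
    dot (c + t *: l) ((dot l (w - x)) *: (y - x) - (dot l (y - x)) *: (w - x)).
    rewrite [in RHS]dotDl [dot (t *: l) _]dotZl !(dotBr (_ *: _)) !dotZr; ring.
  by rewrite (dotBr (_ *: _)) !dotZr cr cw' !mulr0 subrr.
have [u0|un0] := eqVneq ((dot l (w - x)) *: (y - x) - (dot l (y - x)) *: (w - x)) 0.
  have := @not_collinear x y w (dot l (y - x) / dot l (w - x)) xX yX wX.
  rewrite (eq_sym x) yx (eq_sym y) wy eq_sym wx => /(_ isT isT isT); apply.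
  move/eqP: u0; rewrite subr_eq0 => /eqP u0.
  by rewrite mulrC -scalerA -u0 scalerA mulVf ?scale1r ?gt_eqF.
have := cU ((dot l (w - x)) *: (y - x) - (dot l (y - x)) *: (w - x)).
rewrite ku eqxx => h; suff: false by []; apply: h; rewrite mem_filter un0 /=.
apply/allpairsP; exists (y, w); split => //.
Qed.

(** For small [e], improving [c + e *: l] from a maximum of [c] is only possible inside the face of
    [c]. *)
Lemma simplex_face c x z l : maxat c x -> x \in X -> z \in X ->
  dot c z = dot c x -> dot l x < dot l z ->
  exists y, [/\ edge x y, dot c y = dot c x & dot l x < dot l y].
Proof.
move=> cx xX zX cz lz.
pose Y := [seq y <- X | dot c y < dot c x].
have [y|e e0 he] := @small_pos R _ Y (fun y => dot c x - dot c y)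
  (fun y => - (dot l y - dot l x)).
  by rewrite mem_filter subr_gt0 => /andP[].
have [|y xy hy] := @simplex x z (c + e *: l) xX zX.
  by rewrite !dotE cz ltrD2l ltr_pM2l.
have [_ yX] := edgeX xy.
move: hy; rewrite !dotE => hy.
have [cy|cy] := eqVneq (dot c y) (dot c x).
  by exists y; split=> //; move: hy; rewrite cy ltrD2l ltr_pM2l.
have := he y; rewrite mem_filter yX lt_neqAle cy cx //= => /(_ isT).
by lra.
Qed.

Definition planar (G : pred 'rV[R]_d) e1 e2 := forall z z', G z -> G z' ->
  exists a b, z - z' = a *: e1 + b *: e2.

(** Three edge directions in a plane are linearly related. A functional exposing one of the edges
    kills that term and is negative on the two others, so the remaining two coefficients have
    opposite signs or vanish. *)
Lemma planar_degree (G : pred 'rV[R]_d) e1 e2 x y1 y2 y3 :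
  planar G e1 e2 -> G x -> G y1 -> G y2 -> G y3 ->
  edge x y1 -> edge x y2 -> edge x y3 -> [\/ y1 = y2, y1 = y3 | y2 = y3].
Proof.
move=> pl Gx G1 G2 G3 /edgeP[xX y1X xy1 [c1 [e1x h1]]]
  /edgeP[_ y2X xy2 [c2 [e2x h2]]] /edgeP[_ y3X xy3 [c3 [e3x h3]]].
have [->|n12] := eqVneq y1 y2; first by constructor 1.
have [->|n13] := eqVneq y1 y3; first by constructor 2.
have [->|n23] := eqVneq y2 y3; first by constructor 3.
exfalso.
have [a1 [b1 u1]] := pl _ _ G1 Gx; have [a2 [b2 u2]] := pl _ _ G2 Gx.
have [a3 [b3 u3]] := pl _ _ G3 Gx.
(* Cramer's relation: the coefficients are the 2 by 2 minors of the coordinates. *)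
have rel : (a2 * b3 - a3 * b2) *: (y1 - x) + (a3 * b1 - a1 * b3) *: (y2 - x)
  + (a1 * b2 - a2 * b1) *: (y3 - x) = 0.
  by rewrite u1 u2 u3; apply/rowP => i; rewrite !mxE; ring.
set A1 := a2 * b3 - a3 * b2 in rel; set A2 := a3 * b1 - a1 * b3 in rel.
set A3 := a1 * b2 - a2 * b1 in rel.
have R1 : A2 * (dot c1 y2 - dot c1 x) + A3 * (dot c1 y3 - dot c1 x) = 0.
  by have := congr1 (dot c1) rel; rewrite !dotE -e1x; lra.
have R2 : A1 * (dot c2 y1 - dot c2 x) + A3 * (dot c2 y3 - dot c2 x) = 0.
  by have := congr1 (dot c2) rel; rewrite !dotE -e2x; lra.
have R3 : A1 * (dot c3 y1 - dot c3 x) + A2 * (dot c3 y2 - dot c3 x) = 0.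
  by have := congr1 (dot c3) rel; rewrite !dotE -e3x; lra.
have q21 : dot c1 y2 - dot c1 x < 0 by rewrite subr_lt0 h1 // eq_sym.
have q31 : dot c1 y3 - dot c1 x < 0 by rewrite subr_lt0 h1 // eq_sym.
have q12 : dot c2 y1 - dot c2 x < 0 by rewrite subr_lt0 h2 // eq_sym.
have q32 : dot c2 y3 - dot c2 x < 0 by rewrite subr_lt0 h2 // eq_sym.
have q13 : dot c3 y1 - dot c3 x < 0 by rewrite subr_lt0 h3 // eq_sym.
have q23 : dot c3 y2 - dot c3 x < 0 by rewrite subr_lt0 h3 // eq_sym.
have A30 : A3 = 0 := opposite_signs3 q21 q31 q12 q32 q13 q23 R1 R2 R3.
have z1 : b2 *: (y1 - x) - b1 *: (y2 - x) = 0.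
  have -> : b2 *: (y1 - x) - b1 *: (y2 - x) = A3 *: e1.
    by rewrite u1 u2 /A3; apply/rowP => i; rewrite !mxE; ring.
  by rewrite A30 scale0r.
have z2 : a2 *: (y1 - x) - a1 *: (y2 - x) = 0.
  have -> : a2 *: (y1 - x) - a1 *: (y2 - x) = (- A3) *: e2.
    by rewrite u1 u2 /A3; apply/rowP => i; rewrite !mxE; ring.
  by rewrite A30 oppr0 scale0r.
(* The functional [c1] vanishes on [y1 - x] but not on [y2 - x]; both coordinates of [y1 - x] thus
   turn out to be zero. *)
have kill (a b : R) : a *: (y1 - x) - b *: (y2 - x) = 0 -> b = 0.
  move/(congr1 (dot c1)); rewrite !dotE -e1x => e.
  apply/eqP; rewrite -(mulIr_eq0 _ (mulIf (negbT (lt_eqF q21)))).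
  by apply/eqP; lra.
have b10 := kill _ _ z1; have a10 := kill _ _ z2.
move: u1; rewrite a10 b10 !scale0r addr0 => /eqP.
by rewrite subr_eq0 eq_sym (negbTE xy1).
Qed.

End Config.

Section PathSucc.
Variable T : eqType.
Implicit Types (x z : T) (p s : seq T) (e : rel T).

Lemma path_succ e x p z : path e x p -> z \in x :: p -> z != last x p ->
  exists2 c, c \in p & e z c.
Proof.
elim: p x => [|y p ih] x /=; first by rewrite inE => _ /eqP ->; rewrite eqxx.
case/andP=> exy py; rewrite inE => /orP[/eqP ->|zp] zl.
  by exists y => //; rewrite inE eqxx.
by have [c cp ec] := ih _ py zp zl; exists c; rewrite ?inE ?cp ?orbT.
Qed.

Lemma path_pred e x p z : path e x p -> z \in p ->
  exists2 a, a \in x :: p & e a z.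
Proof.
elim: p x => [|y p ih] x //= /andP[exy py]; rewrite inE => /orP[/eqP ->|zp].
  by exists x => //; rewrite inE eqxx.
by have [c cp ec] := ih _ py zp; exists c => //; rewrite inE cp orbT.
Qed.

End PathSucc.

(* The boundary of a polygon: degree at most 2 and no local extrema besides the
   global ones already force a cycle made of two ascending paths. *)
Section Polygon.
Variables (R : realFieldType) (T : eqType) (s : seq T) (e : rel T) (f : T -> R).
Hypothesis s_uniq : uniq s.
Hypothesis e_sym : forall a b, e a b -> e b a.
Hypothesis e_s : forall a b, e a b -> a \in s.
Hypothesis f_inj : {in s &, injective f}.
Definition up : rel T := fun a b => e a b && (f a < f b).
Hypothesis up_ex : forall a b, a \in s -> b \in s -> f a < f b -> exists c, up a c.
Hypothesis down_ex : forall a b, a \in s -> b \in s -> f b < f a -> exists c, up c a.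
Hypothesis deg2 : forall x a b c, e x a -> e x b -> e x c -> [\/ a = b, a = c | b = c].

Lemma up_lt a b : up a b -> f a < f b. Proof. by case/andP. Qed.
Lemma up_e a b : up a b -> e a b. Proof. by case/andP. Qed.
Lemma up_e' a b : up a b -> e b a. Proof. by case/andP => /e_sym. Qed.

Lemma up_s a b : up a b -> (a \in s) /\ (b \in s).
Proof. by case/andP => h _; split; [exact: e_s h | exact: e_s (e_sym h)]. Qed.

(** The number of points strictly above serves as the measure for upward inductions, here and in the
    vertex figure. *)
Lemma rank_up a b : b \in s -> f a < f b ->
  (count (fun w => f b < f w)%R s < count (fun w => f a < f w)%R s)%N.
Proof.
move=> bs ab; rewrite -(size_filter (fun w => f a < f w)) -(size_filter (fun w =>
  f b < f w)).
have -> : [seq w <- s | f b < f w] = [seq w <- [seq w <- s | f a < f w] | f b < f w].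
  rewrite -filter_predI; apply: eq_filter => w /=; case: ltP => //= bw.
  by rewrite (lt_trans ab).
rewrite size_filter -[X in (_ < X)%N](count_predC (fun w => f b < f w)) -addn1 leq_add2l.
rewrite -has_count; apply/hasP; exists b; rewrite ?mem_filter ?ab //=.
by rewrite ltxx.
Qed.

Lemma rank_down a b : b \in s -> f b < f a ->
  (count (fun w => f w < f b)%R s < count (fun w => f w < f a)%R s)%N.
Proof.
move=> bs ab; rewrite -(size_filter (fun w => f w < f a)) -(size_filter (fun w =>
  f w < f b)).
have -> : [seq w <- s | f w < f b] = [seq w <- [seq w <- s | f w < f a] | f w < f b].
  rewrite -filter_predI; apply: eq_filter => w /=; case: ltP => //= bw.
  by rewrite (lt_trans bw).
rewrite size_filter -[X in (_ < X)%N](count_predC (fun w => f w < f b)) -addn1 leq_add2l.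
rewrite -has_count; apply/hasP; exists b; rewrite ?mem_filter ?ab //=.
by rewrite ltxx.
Qed.

Lemma ascend a : a \in s -> exists p, path up a p /\ last a p \in s /\
  forall b, b \in s -> f b <= f (last a p).
Proof.
have [m] := ubnP (count (fun w => f a < f w) s).
elim: m a => // m ih a hm as_.
have [/hasP[b bs ab]|/hasPn h] := boolP (has (fun b => f a < f b) s); last first.
  by exists [::]; split=> //; split=> // b /h; rewrite -leNgt.
have [c ac] := up_ex as_ bs ab; have [_ cs] := up_s ac.
have [|p [pp h]] := ih c _ cs.
  by apply: leq_trans (rank_up cs (up_lt ac)) _; rewrite -ltnS.
by exists (c :: p); rewrite /= ac.
Qed.

Lemma up_path_lt a p z : path up a p -> z \in p -> f a < f z.
Proof.
move=> pp zp; have : path (fun a b => f a < f b) a p.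
  by apply: sub_path pp => ? ? /up_lt.
by move/(order_path_min (fun _ _ _ => @lt_trans _ _ _ _ _))/allP; apply.
Qed.

Lemma up_path_uniq a p : path up a p -> uniq (a :: p).
Proof.
move=> pp; apply: (@sorted_uniq _ (fun a b => f a < f b)).
- by move=> ? ? ?; apply: lt_trans.
- by move=> ?; rewrite /= ltxx.
by apply: sub_path pp => ? ? /up_lt.
Qed.

Lemma up_path_s a p : path up a p -> a \in s -> {subset a :: p <= s}.
Proof.
elim: p a => [|b p ih] a /=; first by move=> _ as_ z; rewrite inE => /eqP ->.
case/andP=> ab pp as_ z; rewrite inE => /orP[/eqP -> //|].
by apply: ih => //; case: (up_s ab).
Qed.

(** Ascents from [y] and [y'] both reach the unique maximum. They meet only there and, with [x],
    cover [s]; counting the shared end once gives [1 + (size p + 1) + (size p' + 1) - 1]. *)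
Lemma polygon x y y' : up x y -> up x y' -> y != y' ->
  exists p p', [/\ path up x (y :: p), path up x (y' :: p'),
    last y p = last y' p' & (size p + size p' + 2 = size s)%N].
Proof.
move=> xy xy' nyy'.
have [xs ys] := up_s xy; have [_ ys'] := up_s xy'.
have [p [pp [ls lm]]] := ascend ys; have [p' [pp' [ls' lm']]] := ascend ys'.
have ll : last y p = last y' p'.
  by apply: f_inj => //; apply/eqP; rewrite eq_le lm' ?lm.
exists p, p'; split; rewrite /= ?xy ?xy' //.
(* By the degree bound, a point with an upper neighbour has at most one lower neighbour; [key'] is
   the mirror image. *)
have key z a b c : e z a -> e z b -> e z c -> f a < f z -> f b < f z -> f z < f c -> a = b.
  move=> za zb zc az bz cz; case: (deg2 za zb zc) => // E; first by move: cz;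
    rewrite -E ltNge ltW.
  by move: cz; rewrite -E ltNge ltW.
have key' z a b c : e z a -> e z b -> e z c -> f z < f a -> f z < f b -> f c < f z -> a = b.
  move=> za zb zc az bz cz; case: (deg2 za zb zc) => // E; first by move: cz;
    rewrite -E ltNge ltW.
  by move: cz; rewrite -E ltNge ltW.
have xA z : z \in y :: p -> f x < f z by apply: up_path_lt; rewrite /= xy.
have xB z : z \in y' :: p' -> f x < f z by apply: up_path_lt; rewrite /= xy'.
have upA z : z \in y :: p -> z != last y p -> exists2 c, c \in p & up z c.
  exact: path_succ.
have upB z : z \in y' :: p' -> z != last y' p' -> exists2 c, c \in p' & up z c.
  exact: path_succ.
have dnA z : z \in y :: p -> z = y \/ exists2 a, a \in y :: p & up a z.
  by rewrite inE => /orP[/eqP|/(path_pred pp)]; [left|right].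
have dnB z : z \in y' :: p' -> z = y' \/ exists2 a, a \in y' :: p' & up a z.
  by rewrite inE => /orP[/eqP|/(path_pred pp')]; [left|right].
(* A shared point below the maximum has a single lower neighbour. It cannot be [x] on just one side,
   so it is shared too, and by induction it would be the maximum. *)
have disj z : z \in y :: p -> z \in y' :: p' -> z = last y p.
  have [m] := ubnP (count (fun w => f w < f z) s).
  elim: m z => // m ih z hm zA zB; apply/eqP/contraT => zl.
  have [c _ zc] := upA _ zA zl.
  have gen a b : up a z -> up b z -> a = b.
    move=> az bz.
    exact: (key z a b c (up_e' az) (up_e' bz) (up_e zc) (up_lt az) (up_lt bz) (up_lt zc)).
  case: (dnA _ zA) (dnB _ zB) => [E|[a aA az]] [E'|[b bB bz]].
  - by move: nyy'; rewrite -E -E' eqxx.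
  - have E1 : b = x by apply: gen => //; rewrite E.
    by have := xB _ bB; rewrite E1 ltxx.
  - have E1 : a = x by apply: gen => //; rewrite E'.
    by have := xA _ aA; rewrite E1 ltxx.
  have ab := gen _ _ az bz; rewrite -{}ab in bB bz.
  have aE : a = last y p.
    apply: ih => //; apply: leq_trans (rank_down (up_s az).1 (up_lt az)) _.
    by rewrite -ltnS.
  have := lm z (up_s az).2; rewrite -aE leNgt.
  by rewrite (up_lt az).
have xmin b : b \in s -> f x <= f b.
  move=> bs; rewrite leNgt; apply/negP => bx; have [c cx] := down_ex xs bs bx.
  have := key' x y y' c (up_e xy) (up_e xy') (up_e' cx) (up_lt xy) (up_lt xy') (up_lt cx).
  by move/eqP; rewrite (negbTE nyy').
(* A lower neighbour of [z] is covered by induction, and the only way up from it continues along its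
   path. *)
have cov z : z \in s -> [\/ z = x, z \in y :: p | z \in y' :: p'].
  have [m] := ubnP (count (fun w => f w < f z) s).
  elim: m z => // m ih z hm zs.
  have [->|zx] := eqVneq z x; first by constructor 1.
  have [|w wz] := @down_ex z x zs xs.
    rewrite lt_neqAle xmin // andbT; apply: contra zx => /eqP E.
    by apply/eqP/esym/f_inj.
  have [ws _] := up_s wz.
  have [||wA|wB] := ih w _ ws.
  - by apply: leq_trans (rank_down ws (up_lt wz)) _; rewrite -ltnS.
  - move=> E; rewrite E in wz.
    case: (deg2 (up_e xy) (up_e xy') (up_e wz)) => E1.
    + by move: nyy'; rewrite E1 eqxx.
    + by rewrite -E1; constructor 2; rewrite inE eqxx.
    + by rewrite -E1; constructor 3; rewrite inE eqxx.
  - have wl : w != last y p.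
      by apply: contraTneq (up_lt wz) => ->; rewrite -leNgt lm.
    have [c cA wc] := upA _ wA wl.
    have [a aw] : exists a, up a w by case: (dnA _ wA) => [->|[a _ ?]]; [exists x|exists a].
    constructor 2; have <- : c = z.
      exact: (key' w c z a (up_e wc) (up_e wz) (up_e' aw) (up_lt wc) (up_lt wz) (up_lt aw)).
    by rewrite inE cA orbT.
  have wl : w != last y' p'.
    by apply: contraTneq (up_lt wz) => ->; rewrite -leNgt lm'.
  have [c cB wc] := upB _ wB wl.
  have [a aw] : exists a, up a w by case: (dnB _ wB) => [->|[a _ ?]]; [exists x|exists a].
  constructor 3; have <- : c = z.
    exact: (key' w c z a (up_e wc) (up_e wz) (up_e' aw) (up_lt wc) (up_lt wz) (up_lt aw)).
  by rewrite inE cB orbT.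
have uB := up_path_uniq pp'; rewrite lastI rcons_uniq in uB; case/andP: uB => lB uB.
have uA := up_path_uniq pp.
have bB z : z \in belast y' p' -> z \in y' :: p' by rewrite lastI mem_rcons inE => ->;
  rewrite orbT.
have U : uniq (x :: (y :: p) ++ belast y' p').
  rewrite cons_uniq cat_uniq uA uB andbT mem_cat negb_or; apply/andP; split.
    apply/andP; split; apply/negP; first by move/xA; rewrite ltxx.
    by move/bB/xB; rewrite ltxx.
  apply/hasPn => z zB; apply/negP => zA.
  by move: lB; rewrite -ll -(disj z zA (bB _ zB)) zB.
have E : x :: (y :: p) ++ belast y' p' =i s.
  move=> z; apply/idP/idP.
    rewrite inE mem_cat => /or3P[/eqP -> //|zA|/bB zB].
      exact: (up_path_s pp).
    exact: (up_path_s pp').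
  rewrite inE mem_cat => /cov[->|->|]; rewrite ?eqxx ?orbT //.
  rewrite lastI mem_rcons inE => /orP[/eqP ->|->]; last by rewrite !orbT.
  by rewrite -ll mem_last orbT.
have := perm_size (uniq_perm U s_uniq E).
by rewrite /= size_cat /= size_belast addn2.
Qed.

End Polygon.

(** * Products of reflections *)

Section Reflections.
Variables (R : realFieldType) (d : nat).
Implicit Types u v w x y z c q r : 'rV[R]_d.

Lemma mul_trmx_dot u v : u *m v^T = (dot u v)%:M.
Proof.
apply/matrixP => i j; rewrite !ord1 !mxE eqxx mulr1n.
by apply: eq_bigr => k _; rewrite mxE.
Qed.

(** Acts on row vectors from the right; at [r = 0] it is the identity, so it is an involution and an
    isometry for every [r]. *)
Definition reflmx r : 'M[R]_d := 1%:M - (2 / dot r r) *: (r^T *m r).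

Lemma mul_reflmx v r : v *m reflmx r = v - (2 * dot v r / dot r r) *: r.
Proof.
rewrite mulmxBr mulmx1 -scalemxAr mulmxA mul_trmx_dot mul_scalar_mx scalerA.
by congr (_ - _ *: _); rewrite mulrAC.
Qed.

Lemma reflmxZ k r : k != 0 -> reflmx (k *: r) = reflmx r.
Proof.
move=> k0; rewrite /reflmx; congr (_ - _); rewrite !dotE.
rewrite [(k *: r)^T]linearZ /= -scalemxAl -scalemxAr !scalerA; congr (_ *: _).
have [->|r0] := eqVneq r 0; first by rewrite dot0l !mulr0 invr0 !mulr0 !mul0r.
have := dot_gt0 r0 => h; field.
by rewrite k0 gt_eqF.
Qed.

Lemma reflmxN r : reflmx (- r) = reflmx r.
Proof. by rewrite -scaleN1r reflmxZ // oppr_eq0 oner_eq0. Qed.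

Lemma reflmx_sym x y : reflmx (x - y) = reflmx (y - x).
Proof. by rewrite -reflmxN opprB. Qed.

Lemma dot_reflmx u v r : dot (u *m reflmx r) (v *m reflmx r) = dot u v.
Proof.
rewrite !mul_reflmx !dotE.
have [->|r0] := eqVneq r 0; first by rewrite !dot0r !dot0l; ring.
have := dot_gt0 r0 => h; rewrite (dotC r v); field.
by rewrite gt_eqF.
Qed.

Lemma reflmxK r : reflmx r *m reflmx r = 1%:M.
Proof.
suff H (v : 'rV_d) : v *m reflmx r *m reflmx r = v.
  by apply/row_matrixP => i; rewrite !rowE mulmxA H mulmx1.
rewrite !mul_reflmx.
have [->|r0] := eqVneq r 0; first by rewrite !scaler0 !subr0.
rewrite -addrA -opprD -scalerDl !dotE.
set k := (X in X *: r); suff -> : k = 0 by rewrite scale0r subr0.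
have := dot_gt0 r0 => h; rewrite /k; field.
by rewrite gt_eqF.
Qed.

(** The vector [x - y] is normal to the wall between the normal cones of [x] and [y]. Since rows are
    multiplied from the right, factors appear in walking order. *)
Fixpoint walk_mx x (p : seq 'rV[R]_d) : 'M[R]_d :=
  if p is y :: p' then reflmx (x - y) *m walk_mx y p' else 1%:M.

Lemma walk_mx_cat x p (q : seq _) : walk_mx x (p ++ q) =
  walk_mx x p *m walk_mx (last x p) q.
Proof. by elim: p x => [|y p ih] x /=; rewrite ?mul1mx // ih mulmxA. Qed.

Lemma dot_walk_mx x p u v : dot (u *m walk_mx x p) (v *m walk_mx x p) = dot u v.
Proof.
elim: p x u v => [|y p ih] x u v /=; first by rewrite !mulmx1.
by rewrite !mulmxA ih dot_reflmx.
Qed.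

Lemma last_rev_belast x p : last (last x p) (rev (belast x p)) = x.
Proof. by case: p => [|y p] //=; rewrite rev_cons last_rcons. Qed.

Lemma walk_mx_rev x p : walk_mx x p *m walk_mx (last x p) (rev (belast x p)) = 1%:M.
Proof.
elim: p x => [|y p ih] x /=; first by rewrite mulmx1.
rewrite rev_cons -cats1 walk_mx_cat last_rev_belast /= mulmx1.
by rewrite mulmxA -(mulmxA (reflmx _)) ih mulmx1 reflmx_sym reflmxK.
Qed.

Lemma walk_mx_unit x p : walk_mx x p \in unitmx.
Proof. by case/mulmx1_unit: (walk_mx_rev x p). Qed.

(** In use, [w] gives the vertices of an inscribed polytope relative to its center. *)
Lemma walk_mx_carry (step : rel 'rV[R]_d) (w : 'rV[R]_d -> 'rV[R]_d) x p :
  (forall a b, step a b -> w a *m reflmx (a - b) = w b) ->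
  path step x p -> w x *m walk_mx x p = w (last x p).
Proof.
move=> hw; elim: p x => [|y p ih] x /=; first by rewrite mulmx1.
by case/andP=> /hw e /ih; rewrite mulmxA e.
Qed.

Section Planar.
Variables e1 e2 : 'rV[R]_d.

(* An area form on the plane spanned by [e1] and [e2], pulled back along the
   orthogonal projection. *)
Definition omega u v := dot e1 u * dot e2 v - dot e2 u * dot e1 v.

Definition in_span u := exists a b, u = a *: e1 + b *: e2.

(** As [r] lies in the plane, the reflection commutes with the projection onto it and acts there
    with determinant -1. *)
Lemma omega_reflmx r u v : in_span r -> r != 0 ->
  omega (u *m reflmx r) (v *m reflmx r) = - omega u v.
Proof.
case=> a [b er] /dot_gt0; rewrite !mul_reflmx /omega.
have E z : dot z r = a * dot e1 z + b * dot e2 z.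
  by rewrite er !dotE !(dotC z).
rewrite !dotE (E u) (E v) (E r) => h; field.
by rewrite gt_eqF.
Qed.

Lemma omegaB u v w : omega (u - v) w = omega u w - omega v w.
Proof. by rewrite /omega !dotE; ring. Qed.

Lemma in_span0 : in_span 0.
Proof. by exists 0, 0; rewrite !scale0r addr0. Qed.

Lemma in_spanB u v : in_span u -> in_span v -> in_span (u - v).
Proof.
move=> [a [b ->]] [a' [b' ->]]; exists (a - a'), (b - b').
by apply/rowP => i; rewrite !mxE; ring.
Qed.

Lemma in_spanZ k u : in_span u -> in_span (k *: u).
Proof.
move=> [a [b ->]]; exists (k * a), (k * b).
by apply/rowP => i; rewrite !mxE; ring.
Qed.

Variable step : rel 'rV[R]_d.
Hypothesis step_planar : forall a b, step a b -> a != b /\ in_span (a - b).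

Lemma omega_walk_mx x p u v : path step x p ->
  omega (u *m walk_mx x p) (v *m walk_mx x p) = (-1) ^+ size p * omega u v.
Proof.
elim: p x u v => [|y p ih] x u v /=; first by rewrite !mulmx1 mul1r.
case/andP=> /step_planar[xy sp] pp; rewrite !mulmxA ih // omega_reflmx ?subr_eq0 //.
by rewrite exprS mulN1r mulrN mulNr.
Qed.

Lemma walk_mx_in_span x p v : path step x p -> in_span (v *m walk_mx x p - v).
Proof.
elim: p x v => [|y p ih] x v /=.
  by rewrite mulmx1 subrr => _; exact: in_span0.
case/andP=> /step_planar[_ sp] pp; rewrite mulmxA.
set t := walk_mx y p; set u := v *m reflmx _.
have -> : u *m t - v = (u *m t - u) - (v - u) by rewrite opprB addrA subrK.
apply: in_spanB; first exact: ih.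
rewrite /u mul_reflmx subKr; exact: in_spanZ.
Qed.

(** Both [dot e1 w] and [dot e2 w], multiplied by [dot D D], are combinations of [dot D w] and
    [omega D w]. *)
Lemma planar_orth_eq0 D w : in_span D -> dot D w = 0 -> omega D w = 0 ->
  ~ (dot e1 w = 0 /\ dot e2 w = 0) -> D = 0.
Proof.
move=> [a [b eD]] Dw oD nw; apply/eqP; rewrite -dot_eq0.
have DD : dot D D = a * dot e1 D + b * dot e2 D by rewrite {1}eD !dotE.
have Dw' : a * dot e1 w + b * dot e2 w = 0 by rewrite -Dw {1}eD !dotE.
move: oD; rewrite /omega => oD; apply/negPn/negP => D0; apply: nw.
have k1 : dot e1 w * dot D D = - b * (dot e1 D * dot e2 w - dot e2 D * dot e1 w) +
   (a * dot e1 w + b * dot e2 w) * dot e1 D by rewrite DD; ring.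
have k2 : dot e2 w * dot D D = a * (dot e1 D * dot e2 w - dot e2 D * dot e1 w) +
   (a * dot e1 w + b * dot e2 w) * dot e2 D by rewrite DD; ring.
move: k1 k2; rewrite oD Dw' !mulr0 !mul0r !addr0 => /eqP k1 /eqP k2.
by move: k1 k2; rewrite !mulf_eq0 (negbTE D0) !orbF => /eqP -> /eqP ->.
Qed.

(* In the plane, an isometry is determined by its orientation and the image of
   one nonzero vector. *)
Lemma walk_mx_unique (w : 'rV[R]_d -> 'rV[R]_d) x y p p' :
  (forall a b, step a b -> w a *m reflmx (a - b) = w b) ->
  step x y -> w x != w y -> path step x p -> path step x p' ->
  last x p = last x p' -> odd (size p) = odd (size p') -> walk_mx x p = walk_mx x p'.
Proof.
move=> hw xy wxy pp pp' ll odd_eq; apply/row_matrixP => i; rewrite !rowE.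
set v := delta_mx 0 i; apply/eqP; rewrite -subr_eq0; apply/eqP.
have wp := walk_mx_carry hw pp; have wp' := walk_mx_carry hw pp'.
apply: (@planar_orth_eq0 _ (w (last x p))).
- have -> : v *m walk_mx x p - v *m walk_mx x p' =
  (v *m walk_mx x p - v) - (v *m walk_mx x p' - v).
    by rewrite opprB addrA subrK.
  by apply: in_spanB; apply: walk_mx_in_span.
- by rewrite dotBl -{1}wp ll -wp' !dot_walk_mx subrr.
- rewrite omegaB -{1}wp ll -wp' !omega_walk_mx // -!(signr_odd _ (size _)) odd_eq.
  by rewrite subrr.
(* If the carried vector were orthogonal to the plane, [w x] would be orthogonal to [x - y] and
   fixed by the first reflection. *)
case=> o1 o2; move: wxy; rewrite -(hw _ _ xy) => /eqP; apply.
have [nxy sp] := step_planar xy.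
have : dot (w x) (x - y) = 0.
  rewrite -(dot_walk_mx x p) wp.
  have : in_span ((x - y) *m walk_mx x p).
    have := walk_mx_in_span (x - y) pp => h.
    have := in_spanB h (in_spanZ (-1) sp); rewrite scaleN1r opprK subrK //.
  by case=> a [b ->]; rewrite !dotE !(dotC (w _)) o1 o2 !mulr0 addr0.
by rewrite mul_reflmx => ->; rewrite mulr0 mul0r scale0r subr0.
Qed.

End Planar.
End Reflections.

(** * 2-faces and monodromy *)

Section TwoFaces.
Variables (R : realFieldType) (d : nat) (X : seq 'rV[R]_d).
Implicit Types u v w x y z c q l g : 'rV[R]_d.

Hypothesis Hexp : forall x, x \in X -> exists c, exposes X c x.
Local Notation edge := (edge X).

Definition in_face c x : pred 'rV[R]_d := fun z => (z \in X) && (dot c z == dot c x).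

(** The [undup] matters because the list of vertices may contain repetitions. *)
Definition face_seq c x := [seq z <- undup X | dot c z == dot c x].

Definition two_face c x := [/\ x \in X, maxat X c x,
  exists e1 e2, forall z z', in_face c x z -> in_face c x z' -> in_span e1 e2 (z - z')
  & exists y z, [/\ in_face c x y, in_face c x z, y != x &
    forall k, z - x <> k *: (y - x)]].

Lemma in_faceW c x z : in_face c x z -> z \in X. Proof. by case/andP. Qed.

Lemma in_face_seq c x z : (z \in face_seq c x) = in_face c x z.
Proof. by rewrite mem_filter mem_undup andbC. Qed.

Lemma in_face_refl c x : x \in X -> in_face c x x.
Proof. by move=> xX; rewrite /in_face xX eqxx. Qed.

(* A pivot of the simplex method in the vertex figure at [x]. *)
Lemma vertex_figure_step x y z g : edge x y -> dot g x = dot g y -> z \in X ->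
  dot g x < dot g z ->
  exists c y', [/\ two_face c x, in_face c x y, in_face c x y', edge x y'
    & dot g x < dot g y'].
Proof.
case/edgeP=> xX yX xy [cy [cxy hcy]] gxy zX gxz.
pose Y := [seq w <- X | (w != x) && (w != y)].
pose h a b := (dot g (b - x)) *: (a - x) - (dot g (a - x)) *: (b - x).
(* A tie of [a] and [b] at the pivot makes [c] vanish on [h a b]. For generic [c] this leaves only
   multiples of [y - x], so all tied points stay in one plane. *)
pose U := [seq p <- allpairs h Y Y | ~~ asb (exists k, p = k *: (y - x))].
have [||u k|c [cq cY cU]] := @generic_perturb R d (y - x) cy [seq x - w | w <- Y] U.
- by rewrite dotBr cxy subrr.
- move=> a /mapP[w]; rewrite mem_filter => /andP[/andP[wx wy] wX] ->.
  by rewrite dotBr subr_gt0 hcy.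
- by rewrite mem_filter => /andP[/asbP n _] E; apply: n; exists k.
have gq : dot g (y - x) = 0 by rewrite dotBr gxy subrr.
have cYlt w : w \in Y -> dot c (w - x) < 0.
  by move=> wY; have := cY (x - w) (map_f _ wY); rewrite !dotE; lra.
have zY : z \in Y.
  by rewrite mem_filter zX andbT; apply/andP; split; apply: contraTneq gxz => ->;
    rewrite ?gxy ltxx.
have [||t [t0 [ht [r rY [gr cr]]]]] :=
  @ratio_test R d ((y - x) :: [seq w - x | w <- Y]) c g.
- move=> r; rewrite inE => /orP[/eqP ->|/mapP[w wY ->]]; first by right.
  by left; apply: cYlt.
- exists (z - x); last by rewrite dotBr subr_gt0.
  by rewrite inE; apply/orP; right; apply/mapP; exists z.
have {rY} [z0 z0Y er] : exists2 z0, z0 \in Y & r = z0 - x.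
  move: rY; rewrite inE => /orP[/eqP E|/mapP[z0 z0Y ->]]; last by exists z0.
  by move: gr; rewrite E gq ltxx.
rewrite {}er in gr cr.
pose f := c + t *: g.
have fq : dot f (y - x) = 0 by rewrite /f dotDl dotZl cq gq mulr0 addr0.
have fx w : (dot f w == dot f x) = (dot f (w - x) == 0) by rewrite dotBr subr_eq0.
have [xy' [z0x z0y] z0X] : [/\ y != x, z0 != x /\ z0 != y & z0 \in X].
  by move: z0Y; rewrite eq_sym mem_filter => /andP[/andP[]].
have fmax : maxat X f x.
  move=> w wX; rewrite -subr_le0 -dotBr.
  have [->|wx] := eqVneq w x; first by rewrite subrr dot0r.
  have [->|wy] := eqVneq w y; first by rewrite fq.
  apply: ht; rewrite inE; apply/orP; right; apply: (map_f (fun w => w - x)).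
  by rewrite mem_filter wx wy.
have fy : in_face f x y by rewrite /in_face yX fx fq eqxx.
have fz0 : in_face f x z0 by rewrite /in_face z0X fx cr eqxx.
have indep k : z0 - x <> k *: (y - x).
  by move=> E; move: gr; rewrite E dotZr gq mulr0 ltxx.
have sp w : in_face f x w -> in_span (y - x) (z0 - x) (w - x).
  case/andP=> wX; rewrite fx => /eqP fw.
  have [->|wx] := eqVneq w x; first by rewrite subrr; exact: in_span0.
  have [->|wy] := eqVneq w y; first by exists 1, 0; rewrite scale1r scale0r addr0.
  have wY : w \in Y by rewrite mem_filter wx wy.
  have gw : 0 < dot g (w - x).
    have := cYlt _ wY; move: fw; rewrite /f dotDl dotZl => h1 h2.
    by rewrite -(pmulr_rgt0 _ t0); lra.
  have cu : dot c (h w z0) = 0.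
    have -> : dot c (h w z0) = dot f (h w z0).
      by rewrite /f /h (dotDl c) (dotZl t) !(dotBr (_ *: _)) !dotZr; ring.
    by rewrite /h (dotBr (_ *: _)) !dotZr fw cr !mulr0 subrr.
  have [/asbP[k E]|n] := boolP (asb (exists k, h w z0 = k *: (y - x))); last first.
    have := cU (h w z0); rewrite cu eqxx mem_filter n => H.
    suff: false by []. apply: H; apply/allpairsP; by exists (w, z0).
  exists (k / dot g (z0 - x)), (dot g (w - x) / dot g (z0 - x)).
  have gz0 : dot g (z0 - x) != 0 by rewrite gt_eqF.
  apply: (scalerI gz0); rewrite [RHS]scalerDr !scalerA ![dot g (z0 - x) * _]mulrC.
  by rewrite !divfK // -E /h subrK.
have [|y' [xy1 fy' gy']] := simplex_face Hexp (l := g) fmax xX z0X (eqP (andP fz0).2).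
  by rewrite -subr_gt0 -dotBr.
exists f, y'; split=> //; last first.
  by rewrite /in_face fy' eqxx andbT; case: (edgeX xy1).
split=> //; last by exists y, z0.
exists (y - x), (z0 - x) => w w' /sp h1 /sp h2.
have -> : w - w' = (w - x) - (w' - x) by rewrite opprB addrA subrK.
exact: in_spanB.
Qed.

Variable l : 'rV[R]_d.
Hypothesis l_inj : {in X &, injective (dot l)}.

Definition ascent : rel 'rV[R]_d := up edge (dot l).

Section Face.
Variables c x : 'rV[R]_d.
Variables e1 e2 : 'rV[R]_d.
Hypothesis cx : maxat X c x.
Hypothesis pl : forall z z', in_face c x z -> in_face c x z' -> in_span e1 e2 (z - z').

Definition fedge : rel 'rV[R]_d := fun a b => [&& edge a b, in_face c x a & in_face c x b].

Lemma fedge_planar a b : fedge a b -> a != b /\ in_span e1 e2 (a - b).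
Proof. by case/and3P=> /edgeP[_ _ ? _] fa fb; split=> //; apply: pl. Qed.

Lemma face_paths y y' : fedge x y -> fedge x y' ->
  dot l x < dot l y -> dot l x < dot l y' -> y != y' ->
  exists p p', [/\ path (up fedge (dot l)) x (y :: p), path (up fedge (dot l)) x (y' :: p'),
    last y p = last y' p' & (size p + size p' + 2 = size (face_seq c x))%N].
Proof.
move=> xy xy' ly ly' nyy'.
have cface a : in_face c x a -> maxat X c a.
  by move=> /andP[aX /eqP E] b bX; rewrite E cx.
have climb m a b : in_face c x a -> in_face c x b -> dot m a < dot m b ->
    exists2 e, fedge a e & dot m a < dot m e.
  move=> fa fb lab; have /andP[aX /eqP ca] := fa; have /andP[bX /eqP cb] := fb.
  have [|e [ae ce le]] := simplex_face Hexp (cface _ fa) aX bX _ lab.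
    by rewrite ca cb.
  by exists e => //; rewrite /fedge ae fa /in_face ce ca eqxx (edgeX ae).2.
apply: (@polygon R _ (face_seq c x) fedge (dot l)) => //.
- by rewrite filter_uniq ?undup_uniq.
- by move=> a b /and3P[ab fa fb]; rewrite /fedge (edge_sym ab) fa fb.
- by move=> a b /and3P[_ fa _]; rewrite in_face_seq.
- by move=> a b; rewrite !in_face_seq => /in_faceW aX /in_faceW bX; apply: l_inj.
- move=> a b; rewrite !in_face_seq => fa fb lab.
  by have [e ae le] := climb _ _ _ fa fb lab; exists e; rewrite /up ae le.
- move=> a b; rewrite !in_face_seq => fa fb lab.
  have [|e ae le] := climb (- l) _ _ fa fb; first by rewrite !dotNl ltrN2.
  exists e; move: le; rewrite !dotNl ltrN2 /up => ->; rewrite andbT.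
  by case/and3P: ae => ae _ fe; rewrite /fedge (edge_sym ae) fe fa.
- move=> a y1 y2 y3 /and3P[a1 fa f1] /and3P[a2 _ f2] /and3P[a3 _ f3].
  exact: (@planar_degree R d X (in_face c x) e1 e2 a).
- by rewrite /up xy.
- by rewrite /up xy'.
Qed.

End Face.

(** * Even 2-faces make closed walks trivial *)

Section Monodromy.
Variable w : 'rV[R]_d -> 'rV[R]_d.
Hypothesis w_edge : forall x y, edge x y -> w x *m reflmx (x - y) = w y.
Hypothesis w_neq : forall x y, edge x y -> w x != w y.
Hypothesis evenX : forall c x, two_face c x -> ~~ odd (size (face_seq c x)).

Definition top t := t \in X /\ forall z, z \in X -> dot l z <= dot l t.

(** A relation, because its being single-valued is the point to prove; it then serves as a
    potential. *)
Definition climb_mx x (A : 'M[R]_d) :=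
  exists p, [/\ path ascent x p, top (last x p) & A = walk_mx x p].

Lemma climb_mx_ex x : x \in X -> exists A, climb_mx x A.
Proof.
move=> xX; have [|||p [pp [h1 h2]]] := @ascend R _ X edge (dot l) _ _ _ x xX.
- by move=> a b /edge_sym.
- by move=> a b /edgeX[].
- move=> a b aX bX lab; have [e ae le] := simplex Hexp aX bX lab.
  by exists e; rewrite /up ae.
by exists (walk_mx x p), p.
Qed.

Lemma climb_mx_cons x y A : ascent x y -> climb_mx y A -> climb_mx x (reflmx (x - y) *m A).
Proof. by move=> xy [p [pp tp_ ->]]; exists (y :: p); rewrite /= xy. Qed.

Lemma climb_mx_cat x p A : path ascent x p -> climb_mx (last x p) A ->
  climb_mx x (walk_mx x p *m A).
Proof.
elim: p x => [|y p ih] x /=; first by rewrite mul1mx.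
by case/andP=> xy pp h; rewrite -mulmxA; apply: climb_mx_cons => //; apply: ih.
Qed.

(* The slope is a linear functional on the vertex figure cut out by [c0], and
   its maximum is made to be at [y0] by taking [c0] close to a functional that
   exposes the edge from [x] to [y0]. *)
Lemma exposed_ratio x y0 : ascent x y0 -> exists2 c0, exposes X c0 x &
  forall z, z \in X -> z != x -> z != y0 ->
  dot l (z - x) / dot c0 (x - z) < dot l (y0 - x) / dot c0 (x - y0).
Proof.
move=> /andP[/edgeP[xX yX xy [c [cxy hc]]] ly].
have [b hb] := Hexp xX.
have yx : y0 != x by rewrite eq_sym.
pose Y := [seq z <- X | (z != x) && (z != y0)].
have [z|e e0 he] := @small_pos R _ Y (fun z => dot l (y0 - x) * dot c (x - z))
  (fun z => dot l (y0 - x) * dot b (x - z) - dot l (z - x) * dot b (x - y0)).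
  rewrite mem_filter => /andP[/andP[zx zy] zX].
  by rewrite mulr_gt0 // dotBr subr_gt0 // hc.
have ex : exposes X (c + e *: b) x.
  move=> z zX zx; rewrite !dotDl !dotZl.
  have : e * dot b z < e * dot b x by rewrite ltr_pM2l // hb.
  have [->|zy] := eqVneq z y0; first by rewrite cxy; lra.
  by have := hc _ zX zx zy; lra.
exists (c + e *: b) => // z zX zx zy.
have p1 : 0 < dot (c + e *: b) (x - z) by rewrite dotBr subr_gt0 ex.
have p2 : 0 < dot (c + e *: b) (x - y0) by rewrite dotBr subr_gt0 ex.
rewrite ltr_pdivrMr // mulrAC ltr_pdivlMr //.
have := he z; rewrite mem_filter zx zy zX => /(_ isT).
have cy : dot c (x - y0) = 0 by rewrite dotBr cxy subrr.
rewrite (dotDl c) (dotDl c) !(dotZl e) cy add0r; set P := dot l _; set Q := dot l _.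
set a := dot c _; set a' := dot b _; set b' := dot b _; move: P Q a a' b' => P Q a a' b'.
by lra.
Qed.

Lemma climb_mx_uniq x A B : x \in X -> climb_mx x A -> climb_mx x B -> A = B.
Proof.
have [m] := ubnP (count (fun v => dot l x < dot l v) X).
elim: m x A B => // m IH x A B hm xX.
have IHup y : ascent x y -> forall A B, climb_mx y A -> climb_mx y B -> A = B.
  move=> xy A' B'; have yX : y \in X by case/andP: xy => /edgeX[].
  apply: IH => //; apply: leq_trans (rank_up yX (andP xy).2) _.
  by rewrite -ltnS.
(* The two sides of the 2-face have equal matrices by [walk_mx_unique]. The induction lets the
   climbs from [y] and [y'] be rerouted along these sides and then along a common continuation. *)
have two c y y' A1 A2 : two_face c x -> in_face c x y -> in_face c x y' ->
    ascent x y -> ascent x y' -> y != y' -> climb_mx y A1 -> climb_mx y' A2 ->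
    reflmx (x - y) *m A1 = reflmx (x - y') *m A2.
  move=> tf fy fy' xy xy' nyy' u1 u2.
  have [_ cx [e1 [e2 pl]] _] := tf; have ev := evenX tf.
  have fx := in_face_refl c xX.
  have [|||||p [p' [pp pp' ll sz]]] := face_paths cx pl (y := y) (y' := y') => //.
  - by rewrite /fedge (andP xy).1 fx fy.
  - by rewrite /fedge (andP xy').1 fx fy'.
  - by case/andP: xy.
  - by case/andP: xy'.
  have sub a b : up (fedge c x) (dot l) a b -> ascent a b.
    by case/andP=> /and3P[h _ _] h'; rewrite /ascent /up h.
  have sub' a b : up (fedge c x) (dot l) a b -> fedge c x a b by case/andP.
  have E : walk_mx x (y :: p) = walk_mx x (y' :: p').
    apply: (@walk_mx_unique R d e1 e2 (fedge c x) (fedge_planar pl) w x y) => //.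
    - by move=> a b /and3P[ab _ _]; apply: w_edge.
    - by rewrite /fedge (andP xy).1 fx fy.
    - by apply: w_neq; case/andP: xy.
    - exact: sub_path pp.
    - exact: sub_path pp'.
    (* The lengths of the two sides add up to the number of vertices of the face, so evenness means
       equal parity. *)
    move: ev; rewrite -sz addn2 /= negbK oddD => h; congr (~~ _).
    by case: (odd (size p)) (odd (size p')) h => -[].
  have [ppy ppy'] : path ascent y p /\ path ascent y' p'.
    by split; [move: pp | move: pp']; rewrite /= => /andP[_]; apply: sub_path.
  have tX : last y p \in X.
    have := mem_last y p; rewrite inE => /orP[/eqP ->|]; first exact: in_faceW fy.
    by case/(path_pred ppy) => a _ /andP[/edgeX[]].
  have [T hT] := climb_mx_ex tX.
  rewrite (IHup _ xy _ _ u1 (climb_mx_cat ppy hT)).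
  rewrite ll in hT; rewrite (IHup _ xy' _ _ u2 (climb_mx_cat ppy' hT)).
  by move: E; rewrite /= !mulmxA => ->.
have main y y0 A1 A2 : ascent x y -> ascent x y0 -> climb_mx y A1 -> climb_mx y0 A2 ->
    reflmx (x - y) *m A1 = reflmx (x - y0) *m A2.
  move=> xy xy0; have [c0 c0x hr] := exposed_ratio xy0.
  pose rho z := dot l (z - x) / dot c0 (x - z).
  have [k] := ubnP (count (fun v => rho y < rho v) X).
  elim: k y A1 xy => // k ih y A1 xy hk u1 u2.
  have [E|nyy0] := eqVneq y y0.
    by rewrite E in u1 *; congr (_ *m _); apply: IHup u1 u2.
  have [yX xny] : y \in X /\ x != y by case/andP: xy => /edgeP[].
  have [y0X xny0] : y0 \in X /\ x != y0 by case/andP: xy0 => /edgeP[].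
  have ry : rho y < rho y0 by apply: hr; rewrite // eq_sym.
  have pos z : z \in X -> x != z -> 0 < dot c0 (x - z).
    by move=> zX xz; rewrite dotBr subr_gt0 c0x // eq_sym.
  (* Constant on the edge from [x] to [y]; elsewhere it exceeds its value at [x] exactly where the
     slope [rho] exceeds [rho y]. Each pivot thus raises the slope until [y0] is reached. *)
  pose g := l + rho y *: c0.
  have gE z : dot g z - dot g x = dot l (z - x) - rho y * dot c0 (x - z).
    by rewrite /g !dotBr !dotDl !dotZl; ring.
  have gxy : dot g x = dot g y.
    apply/esym/eqP; rewrite -subr_eq0 gE /rho divfK ?subrr //.
    by rewrite gt_eqF // pos.
  have gpos z : z \in X -> x != z -> (dot g x < dot g z) = (rho y < rho z).
    move=> zX xz; rewrite -subr_gt0 gE subr_gt0 [rho z]/rho ltr_pdivlMr //.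
    exact: pos.
  have [|c [y' [tf fy fy' xy' gy']]] := vertex_figure_step (andP xy).1 gxy y0X.
    by rewrite gpos.
  have [_ y'X xny' _] := edgeP _ _ _ xy'.
  have ry' : rho y < rho y' by rewrite -gpos.
  (* Slopes start positive and grow, so the edges of the chain remain ascending for [l]. *)
  have rho0 : 0 < rho y.
    by rewrite /rho divr_gt0 ?pos // dotBr subr_gt0; case/andP: xy.
  have upxy' : ascent x y'.
    rewrite /ascent /up xy' -subr_gt0 -dotBr.
    by have := lt_trans rho0 ry'; rewrite /rho pmulr_lgt0 // invr_gt0 pos.
  have [A3 u3] := climb_mx_ex y'X.
  rewrite (two c y y' A1 A3) //; last by apply: contraTneq ry' => ->; rewrite ltxx.
  apply: ih => //; apply: leq_trans (rank_up y'X ry') _.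
  by rewrite -ltnS.
case=> [[|y p] [pp tx ->]] [[|y' p'] [pp' tx' ->]] //.
- have := up_path_lt pp' (mem_last y' p'); case: tx => _ /(_ _ (tx'.1)) /=.
  by rewrite leNgt => /negbTE ->.
- have := up_path_lt pp (mem_last y p); case: tx' => _ /(_ _ (tx.1)) /=.
  by rewrite leNgt => /negbTE ->.
move: pp pp' => /= /andP[xy pp] /andP[xy' pp'].
by apply: main => //; [exists p | exists p'].
Qed.

(** The climbing matrices change along an ascending edge by its reflection, and along a descending
    one as well, since reflections are involutions. The product telescopes. *)
Lemma climb_mx_path x p A B : path edge x p -> x \in X ->
  climb_mx x A -> climb_mx (last x p) B -> A = walk_mx x p *m B.
Proof.
elim: p x A => [|y p ih] x A /=.
  by move=> _ xX uA uB; rewrite mul1mx; apply: climb_mx_uniq uA uB.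
case/andP=> xy pp xX uA uB; have [_ yX nxy _] := edgeP _ _ _ xy.
have [C uC] := climb_mx_ex yX; rewrite -mulmxA -(ih y C pp yX uC uB).
have [lt|gt|E] := ltrgtP (dot l x) (dot l y).
- by apply: (climb_mx_uniq xX uA); apply: climb_mx_cons => //; rewrite /ascent /up xy.
- have yx : ascent y x by rewrite /ascent /up (edge_sym xy).
  rewrite (climb_mx_uniq yX uC (climb_mx_cons yx uA)) mulmxA reflmx_sym reflmxK mul1mx //.
by move: nxy; rewrite (l_inj xX yX E) eqxx.
Qed.

Lemma closed_path_trivial x p : path edge x p -> x \in X -> last x p = x ->
  walk_mx x p = 1%:M.
Proof.
move=> pp xX lx; have [A uA] := climb_mx_ex xX.
have uA' : climb_mx (last x p) A by rewrite lx.
have := climb_mx_path pp xX uA uA'; case: uA => q [_ _ ->] E.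
by rewrite -[LHS]mulmx1 -(mulmxV (walk_mx_unit x q)) mulmxA -E.
Qed.

End Monodromy.

(** * Trivial monodromy makes 2-faces even *)

Section Converse.
Hypothesis closed_trivial : forall x p, path edge x p -> x \in X -> last x p = x ->
  walk_mx x p = 1%:M.

Lemma walk_mx_same_end x p p' : path edge x p -> path edge x p' -> x \in X ->
  last x p = last x p' -> walk_mx x p = walk_mx x p'.
Proof.
move=> pp pp' xX ll.
have pr : path edge (last x p') (rev (belast x p')).
  by rewrite rev_path; apply: sub_path pp' => a b /edge_sym.
have := walk_mx_rev x p' => E.
have : walk_mx x (p ++ rev (belast x p')) = 1%:M.
  by apply: closed_trivial => //; rewrite ?cat_path ?pp ?last_cat ?ll ?last_rev_belast.
rewrite walk_mx_cat ll -E => /(congr1 (mulmx^~ (walk_mx x p'))).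
have E' := mulmx1C E.
by rewrite -!mulmxA E' !mulmx1.
Qed.

Lemma argmin_seq (s : seq 'rV[R]_d) x : x \in s ->
  exists2 m, m \in s & forall z, z \in s -> dot l m <= dot l z.
Proof.
elim: s x => // a s ih x _; case: s ih => [|b s] ih.
  by exists a; rewrite ?inE // => z; rewrite inE => /eqP ->.
have [m ms hm] := ih b (mem_head _ _).
have [h|h] := leP (dot l a) (dot l m).
  exists a; first exact: mem_head.
  move=> z; rewrite inE => /orP[/eqP -> //|/hm]; exact: le_trans.
exists m; first by rewrite inE ms orbT.
by move=> z; rewrite inE => /orP[/eqP ->|/hm //]; apply: ltW.
Qed.

Lemma two_face_even c x : two_face c x -> ~~ odd (size (face_seq c x)).
Proof.
case=> xX cx [e1 [e2 pl]] [y [z [fy fz yx ind]]].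
have [|m] := @argmin_seq (face_seq c x) x; first by rewrite in_face_seq in_face_refl.
rewrite in_face_seq => fm hm.
have mX := in_faceW fm; have cm : dot c m = dot c x by case/andP: fm => _ /eqP.
have fmE : in_face c m = in_face c x by rewrite /in_face cm.
have fsE : face_seq c m = face_seq c x by rewrite /face_seq cm.
have cmax : maxat X c m by rewrite /maxat cm.
have above v : in_face c x v -> v != m -> dot l m < dot l v.
  move=> fv vm; rewrite lt_neqAle hm ?in_face_seq // andbT.
  apply: contra vm => /eqP E; apply/eqP/esym/l_inj => //; exact: in_faceW fv.
have [v fv vm] : exists2 v, in_face c x v & v != m.
  have [E|n] := eqVneq x m; last by exists x => //; apply: in_face_refl.
  by exists y; rewrite // -E.
have [|y1 [my1 cy1 ly1]] := simplex_face Hexp cmax mX (in_faceW fv) _ (above _ fv vm).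
  by rewrite cm; case/andP: fv => _ /eqP.
have y1X := (edgeX my1).2.
have fy1 : in_face c x y1 by rewrite /in_face y1X cy1 cm eqxx.
have y1m : y1 != m by case/edgeP: my1; rewrite eq_sym.
(* Otherwise [x], [y], [z] would all lie on the line through [m] and [y1]. *)
have [v2 fv2 indv2] : exists2 v2, in_face c x v2 & forall k, v2 - m <> k *: (y1 - m).
  have dec v' : in_face c x v' ->
    (forall k, v' - m <> k *: (y1 - m)) \/ exists k, v' - m = k *: (y1 - m).
    by move=> _; case: (classic (exists k, v' - m = k *: (y1 - m))); [right|move=> n;
      left => k E; apply: n; exists k].
  have [h|[kx Ex]] := dec _ (in_face_refl c xX); first by exists x => //;
    apply: in_face_refl.
  have [h|[ky Ey]] := dec _ fy; first by exists y.
  have [h|[kz Ez]] := dec _ fz; first by exists z.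
  have Eyx : y - x = (ky - kx) *: (y1 - m) by rewrite scalerBl -Ex -Ey opprB addrA subrK.
  have Ezx : z - x = (kz - kx) *: (y1 - m) by rewrite scalerBl -Ex -Ez opprB addrA subrK.
  have k0 : ky - kx != 0.
    by apply: contra yx => /eqP E; rewrite -subr_eq0 Eyx E scale0r.
  by case: (ind ((kz - kx) / (ky - kx))); rewrite Ezx Eyx scalerA divfK.
(* A functional constant along the first edge and increasing towards [v2]: improving it at [m] gives
   a second edge of the face. *)
pose f := rej (y1 - m) (v2 - m).
have f1 : dot f (y1 - m) = 0 by rewrite rej_orth.
have f2 : 0 < dot f (v2 - m) by rewrite dotC dot_rej dot_gt0 // rej_neq0.
have [||y2 [my2 cy2 fy2']] := simplex_face Hexp cmax mX (in_faceW fv2) (l := f).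
- by rewrite cm; case/andP: fv2 => _ /eqP.
- by rewrite -subr_gt0 -dotBr.
have y2X := (edgeX my2).2.
have fy2 : in_face c x y2 by rewrite /in_face y2X cy2 cm eqxx.
have y2m : y2 != m by case/edgeP: my2; rewrite eq_sym.
have ny : y1 != y2.
  by apply: contraTneq fy2' => <-; rewrite -subr_gt0 -dotBr f1 ltxx.
have pl' a b : in_face c m a -> in_face c m b -> in_span e1 e2 (a - b).
  by rewrite fmE; apply: pl.
have [|||||p [p' [pp pp' ll sz]]] := face_paths cmax pl' (y := y1) (y' := y2) => //.
- by rewrite /fedge my1 fmE fm fy1.
- by rewrite /fedge my2 fmE fm fy2.
- exact: above.
have pf : path (fedge c m) m (y1 :: p) by apply: sub_path pp => a b /andP[].
have pf' : path (fedge c m) m (y2 :: p') by apply: sub_path pp' => a b /andP[].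
have E : walk_mx m (y1 :: p) = walk_mx m (y2 :: p').
  by apply: walk_mx_same_end => //; [move: pf|move: pf']; apply: sub_path => a b /and3P[].
(* A pair of nonzero area lets the signs of the two sides be compared. The witness [u] is [f]
   projected and turned within the plane, for which the area is [dot u u]. *)
have [v3 o3] : exists v, omega e1 e2 f v != 0.
  pose u := dot e1 f *: e2 - dot e2 f *: e1.
  have ou : omega e1 e2 f u = dot u u.
    by rewrite /omega {3}/u dotBl !dotZl.
  exists u; rewrite ou dot_eq0; apply/eqP => u0.
  have [a [b E1]] := pl _ _ fy1 fm.
  have [a' [b' E2]] := pl _ _ fv2 fm.
  have e0 : a * dot e1 f + b * dot e2 f = 0.
    by move: f1; rewrite E1 dotDr !dotZr !(dotC f).
  have v0' : dot e1 f *: e2 = dot e2 f *: e1 by apply/eqP; rewrite -subr_eq0 -/u u0.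
  have z1 : dot e1 f *: (y1 - m) = 0.
    have -> : dot e1 f *: (y1 - m) = (a * dot e1 f) *: e1 + b *: (dot e1 f *: e2).
      by rewrite E1 scalerDr !scalerA (mulrC a) (mulrC b).
    by rewrite v0' scalerA -scalerDl e0 scale0r.
  have z2 : dot e2 f *: (y1 - m) = 0.
    have -> : dot e2 f *: (y1 - m) = a *: (dot e2 f *: e1) + (b * dot e2 f) *: e2.
      by rewrite E1 scalerDr !scalerA (mulrC a) (mulrC b).
    by rewrite -v0' scalerA -scalerDl e0 scale0r.
  move/eqP: z1; move/eqP: z2; rewrite !scaler_eq0 subr_eq0 (negbTE y1m) !orbF.
  move=> /eqP z2 /eqP z1; move: f2; rewrite E2 dotDr !dotZr !(dotC f) z1 z2.
  by rewrite !mulr0 addr0 ltxx.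
have := omega_walk_mx (fedge_planar pl') f v3 pf;
  rewrite E (omega_walk_mx (fedge_planar pl') f v3 pf').
move/(mulIf o3) => /= /eqP; rewrite -signr_odd -(signr_odd _ (size p).+1) (inj_eq (@signr_inj R)) /=.
rewrite -fsE -sz addn2 /= negbK oddD => /eqP /negb_inj ->.
by rewrite addbb.
Qed.

End Converse.
End TwoFaces.

(** * Spans, normal cones and faces *)

Section Dimset.
Variables (R : realFieldType) (vT : vectType R).
Implicit Types (S : vT -> Prop) (U : {vspace vT}).

Lemma free_size_le U (Y : seq vT) : free Y -> (forall x, x \in Y -> x \in U) ->
  (size Y <= \dim U)%N.
Proof. by move=> /eqnP <- h; apply: dimvS; apply/span_subvP. Qed.

Lemma dimset_ext S S' k : (forall x, S x <-> S' x) -> dimset S k -> dimset S' k.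
Proof.
move=> h [[Y [YS [fY sY]]] hk]; split; last by move=> Z ZS; apply: hk => x /ZS /h.
by exists Y; split=> // x /YS /h.
Qed.

Lemma dimset_exists S : exists k, dimset S k.
Proof.
pose P k := asb (exists Y : seq vT, (forall x, x \in Y -> S x) /\ free Y /\ size Y = k).
have P0 : exists k, P k.
  by exists 0%N; apply/asbP; exists [::]; split=> //; rewrite nil_free.
have Pm k : P k -> (k <= \dim (fullv : {vspace vT}))%N.
  by move/asbP=> [Y [_ [fY <-]]]; apply: free_size_le => // x _; rewrite memvf.
case: (ex_maxnP P0 Pm) => k /asbP hk hm; exists k; split=> // Y YS fY.
by apply: hm; apply/asbP; exists Y.
Qed.

Lemma dimset_span S k : dimset S k -> exists U, [/\ \dim U = k,
  forall s, S s -> s \in U & forall U', (forall s, S s -> s \in U') -> (U <= U')%VS].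
Proof.
move=> [[Y [YS [fY sY]]] hk]; exists <<Y>>%VS; split.
- by rewrite -sY; apply/eqnP.
- move=> s Ss; apply/contraT => sn.
  have := hk (s :: Y); rewrite /= sY ltnn free_cons sn fY => h.
  suff: false by []. apply: h => // x; rewrite inE => /orP[/eqP -> //|]; exact: YS.
by move=> U' h; apply/span_subvP => x /YS; apply: h.
Qed.

Lemma dimset_of_span S U : (forall s, S s -> s \in U) ->
  (forall U', (forall s, S s -> s \in U') -> (U <= U')%VS) -> dimset S (\dim U).
Proof.
move=> SU Umin; have [k hk] := dimset_exists S.
have [U2 [dU2 SU2 U2min]] := dimset_span hk.
suff -> : U = U2 by rewrite dU2.
by apply/eqP; rewrite eqEsubv Umin // U2min.
Qed.

Lemma dimset_uniq S k k' : dimset S k -> dimset S k' -> k = k'.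
Proof.
move=> [[Y [YS [fY <-]]] h] [[Y' [YS' [fY' <-]]] h'].
by apply/eqP; rewrite eqn_leq h' // h.
Qed.

End Dimset.

(** * Hyperplanes and their normals *)

Section Orth.
Variables (R : realFieldType) (d : nat).
Implicit Types (u v r : 'rV[R]_d) (S : 'rV[R]_d -> Prop).

Lemma dim_rV k : \dim (fullv : {vspace 'rV[R]_k}) = k.
Proof. by rewrite dimvf /dim /= mul1n. Qed.

Definition orthv u : {vspace 'rV[R]_d} := lker (linfun (mulmxr u^T)).

Lemma mem_orthv u v : (v \in orthv u) = (dot v u == 0).
Proof.
rewrite memv_ker lfunE /= mul_trmx_dot; apply/eqP/eqP => [|->]; last first.
  by apply/matrixP => i j; rewrite !ord1 !mxE.
by move/matrixP => /(_ 0 0); rewrite !mxE eqxx mulr1n.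
Qed.

Lemma dim_orthv u : u != 0 -> \dim (orthv u) = d.-1.
Proof.
move=> u0; pose f : 'Hom('rV[R]_d, 'rV[R]_1) := linfun (mulmxr u^T).
have := limg_ker_dim f fullv.
rewrite capfv dim_rV -/(orthv u) => e.
have le1 : (\dim (limg f) <= 1)%N.
  by apply: leq_trans (dimvS (subvf _)) _; rewrite dim_rV.
have lt : (\dim (orthv u) < d)%N.
  rewrite ltnNge; apply/negP => h.
  have : u \in orthv u.
    by have /eqP -> : orthv u == fullv; [rewrite eqEdim subvf dim_rV | rewrite memvf].
  by rewrite mem_orthv dot_eq0 (negbTE u0).
move: e le1 lt; case: (\dim (limg f)) => [|[|k]] // E _ lt.
  by move: lt; rewrite -[X in (X < _)%N]addn0 E ltnn.
by have := congr1 predn E; rewrite addn1.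
Qed.

Lemma dimset_full_orth S u : dimset S d -> (forall s, S s -> dot s u = 0) -> u = 0.
Proof.
move=> /dimset_span [U [dU _ Umin]] h.
have : (U <= orthv u)%VS by apply: Umin => s /h /eqP; rewrite mem_orthv.
have /eqP -> : U == fullv by rewrite eqEdim subvf dim_rV dU /=.
move/subvP => /(_ u (memvf u)); rewrite mem_orthv dot_eq0; exact: eqP.
Qed.

(** Here [S] spans the whole hyperplane of [r], so [u] is orthogonal to its own projection
    [rej r u], which therefore vanishes. *)
Lemma dimset_hyperplane S r u : r != 0 -> (forall s, S s -> dot s r = 0) ->
  dimset S d.-1 -> (forall s, S s -> dot s u = 0) -> exists k, u = k *: r.
Proof.
move=> r0 Sr /dimset_span [U [dU _ Umin]] Su.
have : (U <= orthv u)%VS by apply: Umin => s /Su /eqP; rewrite mem_orthv.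
have /eqP -> : U == orthv r.
  rewrite eqEdim dU dim_orthv // leqnn andbT.
  by apply: Umin => s /Sr /eqP; rewrite mem_orthv.
move/subvP => /(_ (rej r u)); rewrite !mem_orthv rej_orth eqxx => /(_ isT).
rewrite dotC dot_rej dot_eq0 => /eqP z.
case: (classic (exists k, u = k *: r)) => // n; exfalso.
suff : rej r u != 0 by rewrite z eqxx.
by apply: rej_neq0 => k E; apply: n; exists k.
Qed.

(** The normal picked by [epsilon] is unknown, but it is a nonzero multiple of [r], and [reflmx]
    ignores scaling. *)
Lemma refl_reflmx S r v : r != 0 -> (forall s, S s -> dot s r = 0) ->
  dimset S d.-1 -> refl S v = v *m reflmx r.
Proof.
move=> r0 Sr Sd; rewrite /refl.
set Q := (X in epsilon _ X).
have [u0 uS] : Q (epsilon (inhabits 0) Q).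
  by apply: epsilon_spec; exists r; split=> // x /Sr; rewrite dotC.
move: (epsilon _ _) u0 uS => u u0 uS.
have [|k uk] := dimset_hyperplane (u := u) r0 Sr Sd.
  by move=> s /uS; rewrite dotC.
have k0 : k != 0 by apply: contra u0 => /eqP k0; rewrite uk k0 scale0r.
by rewrite -(reflmxZ r k0) -uk mul_reflmx.
Qed.

End Orth.

(** * Normal cones, vertices and faces of a convex hull *)

Section Polytope.
Variables (R : realFieldType) (d n : nat) (V : 'M[R]_(n, d)).
Implicit Types (c u v x y z : 'rV[R]_d) (l : 'I_n -> R).

Lemma conv_row i : conv V (row i V).
Proof.
exists (fun j => (j == i)%:R); split; first by move=> j; rewrite ler0n.
split; first by rewrite (bigD1 i) //= eqxx big1 ?addr0 // => j /negbTE ->.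
rewrite (bigD1 i) //= eqxx scale1r big1 ?addr0 // => j /negbTE ->.
by rewrite scale0r.
Qed.

Lemma NCP y c : NC V y c <-> forall j, dot c (row j V) <= dot c y.
Proof.
split=> [h j|h x [l [l0 [l1 ->]]]]; first by apply: h; apply: conv_row.
rewrite dot_sumr -[X in _ <= X]mul1r -l1 mulr_suml.
by apply: ler_sum => i _; rewrite dotZr ler_wpM2l.
Qed.

Lemma NC_eq y z c : conv V y -> conv V z -> NC V y c -> NC V z c -> dot c y = dot c z.
Proof. by move=> hy hz cy cz; apply/eqP; rewrite eq_le cy // cz. Qed.

Lemma conv_supp l : (forall i, 0 <= l i) -> \sum_i l i = 1 -> exists k, 0 < l k.
Proof.
move=> l0 l1; case: (classic (exists k, 0 < l k)) => // h; exfalso.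
have : \sum_i l i = 0.
  apply: big1 => i _; apply/eqP; rewrite eq_le l0 andbT leNgt; apply/negP => li.
  by apply: h; exists i.
by rewrite l1 => /eqP; rewrite oner_eq0.
Qed.

(** A weighted average attains the maximum exactly when every value of positive weight does. *)
Lemma NC_conv l c : (forall i, 0 <= l i) -> \sum_i l i = 1 ->
  NC V (\sum_i l i *: row i V) c <-> forall k, 0 < l k -> NC V (row k V) c.
Proof.
move=> l0 l1; have [k0 lk0] := conv_supp l0 l1; set y := \sum_i _.
have cy : conv V y by exists l.
split=> [/NCP h k lk|h].
  have z0 : \sum_i l i * (dot c y - dot c (row i V)) = 0.
    under eq_bigr => i _ do rewrite mulrBr.
    rewrite sumrB -mulr_suml l1 mul1r /y dot_sumr.
    by under [X in _ - X]eq_bigr => i _ do rewrite -dotZr; rewrite subrr.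
  have t0 i : true -> 0 <= l i * (dot c y - dot c (row i V)).
    by move=> _; rewrite mulr_ge0 // subr_ge0.
  have := psumr_eq0P t0 z0 (i := k) isT.
  move/eqP; rewrite mulf_eq0 (gt_eqF lk) /= subr_eq0 => /eqP E.
  by apply/NCP => j; rewrite -E.
have hk0 := h _ lk0.
have E : dot c y = dot c (row k0 V).
  rewrite dot_sumr -[RHS]mul1r -l1 mulr_suml; apply: eq_bigr => i _; rewrite dotZr.
  have := l0 i; rewrite le_eqVlt => /orP[/eqP <-|li]; first by rewrite !mul0r.
  by congr (_ * _); apply: NC_eq; [exact: conv_row | exact: conv_row | exact: h | exact: h].
by apply/NCP => j; rewrite E; move/NCP: hk0.
Qed.

Lemma extreme_supp x l k : extreme (conv V) x -> (forall i, 0 <= l i) ->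
  \sum_i l i = 1 -> x = \sum_i l i *: row i V -> 0 < l k -> row k V = x.
Proof.
move=> [_ ex] l0 l1 xE lk.
have sE : \sum_(i | i != k) l i = 1 - l k
  by rewrite -l1 [in RHS](bigD1 k) //= addrAC subrr add0r.
have t0 : 0 <= 1 - l k by rewrite -sE; apply: sumr_ge0.
move: t0; rewrite le_eqVlt => /orP[/eqP t0|t0].
  rewrite xE (bigD1 k) //= big1 ?addr0; last first.
    move=> i ik; rewrite (_ : l i = 0) ?scale0r //.
    by apply: (psumr_eq0P (P := fun i => i != k)) ik => //; rewrite sE -t0.
  have -> : l k = 1 by lra.
  by rewrite scale1r.
(* The remaining weights, renormalized, put [x] strictly between [row k V] and [z]. *)
pose z := \sum_i (if i == k then 0 else l i / (1 - l k)) *: row i V.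
have zE : (1 - l k) *: z = \sum_(i | i != k) l i *: row i V.
  rewrite /z (bigD1 k) //= eqxx scale0r add0r scaler_sumr.
  apply: eq_bigr => i /negbTE ->; rewrite scalerA mulrC divfK //.
  by rewrite gt_eqF.
have cz : conv V z.
  exists (fun i => if i == k then 0 else l i / (1 - l k)); split.
    by move=> i; case: ifP => // _; rewrite divr_ge0 // ltW.
  split=> //; rewrite (bigD1 k) //= eqxx add0r.
  have -> : \sum_(i | i != k) (if i == k then 0 else l i / (1 - l k)) =
     \sum_(i | i != k) l i / (1 - l k) by apply: eq_bigr => i /negbTE ->.
  by rewrite -mulr_suml sE divff // gt_eqF.
have xE' : x = l k *: row k V + (1 - l k) *: z by rewrite zE xE (bigD1 k).
have := ex _ _ (l k) (conv_row k) cz; rewrite lk -subr_gt0 t0 => /(_ isT xE') E.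
by rewrite xE' -E -scalerDl addrCA subrr addr0 scale1r.
Qed.

Lemma extreme_row x : extreme (conv V) x -> exists i, x = row i V.
Proof.
move=> ex; have [[l [l0 [l1 xE]]] _] := ex; have [k lk] := conv_supp l0 l1.
by exists k; rewrite (extreme_supp ex l0 l1 xE lk).
Qed.

Definition vertices : seq 'rV[R]_d := [seq row i V | i <- enum 'I_n].
Local Notation X := vertices.

Lemma verticesP x : reflect (exists i, x = row i V) (x \in X).
Proof.
apply: (iffP mapP) => [[i _ ->]|[i ->]]; first by exists i.
by exists i; rewrite ?mem_enum.
Qed.

Lemma row_vertices i : row i V \in X. Proof. by apply/verticesP; exists i. Qed.
Hint Resolve row_vertices : core.

Lemma conv_vertices x : x \in X -> conv V x.
Proof. by case/verticesP => i ->; apply: conv_row. Qed.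

Lemma NC_maxat x c : NC V x c <-> maxat X c x.
Proof.
split=> [/NCP h z /verticesP[i ->] //|h]; apply/NCP => j; exact: h.
Qed.

Hypothesis Vvert : forall i, extreme (conv V) (row i V).

Lemma vertex_extreme x : x \in X -> extreme (conv V) x.
Proof. by case/verticesP => i ->. Qed.

(** In the other case of Gordan's alternative, [x] would be a convex combination of rows different
    from [x], against extremality. *)
Lemma vertex_exposed x : x \in X -> exists c, exposes X c x.
Proof.
move=> xX; pose js := [seq j <- enum 'I_n | row j V != x].
have [[c hc]|[l [l0 [i hi li] sl]]] := gordan [seq x - row j V | j <- js].
  exists c => z /verticesP[j ->] jx; rewrite -subr_gt0 -dotBr hc //.
  by apply: (map_f (fun j => x - row j V)); rewrite mem_filter jx mem_enum.
exfalso; rewrite size_map in hi sl.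
have j0 : 'I_n by case: (js) hi => // j.
pose f (i : 'I_(size js)) := nth j0 js i.
have fx k : row (f k) V != x.
  have : f k \in js by apply: mem_nth.
  by rewrite mem_filter => /andP[].
pose L := \sum_(k < size js) l k.
have L0 : 0 < L.
  rewrite /L (bigD1 (Ordinal hi)) //=; apply: ltr_pwDl => //.
  exact: sumr_ge0.
pose lam j := (\sum_(k < size js | f k == j) l k) / L.
have lam0 j : 0 <= lam j by apply: divr_ge0; [exact: sumr_ge0 | exact: ltW].
have lam1 : \sum_j lam j = 1.
  rewrite -mulr_suml.
  have -> : \sum_j \sum_(k < size js | f k == j) l k = L.
    by rewrite /L (partition_big f predT).
  by rewrite divff // gt_eqF.
have E : \sum_j lam j *: row j V = x.
  have e1 : \sum_(k < size js) l k *: row (f k) V = L *: x.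
    apply/eqP; rewrite -subr_eq0 -oppr_eq0 opprB scaler_suml -sumrB; apply/eqP.
    rewrite -[RHS]sl; apply: eq_bigr => k _.
    by rewrite -scalerBr (nth_map j0).
  rewrite (partition_big f predT) //= in e1.
  transitivity (L^-1 *: (L *: x)); last by rewrite scalerA mulVf ?scale1r ?gt_eqF.
  rewrite -e1 scaler_sumr; apply: eq_bigr => j _.
  rewrite /lam mulrC -scalerA scaler_suml; congr (_ *: _).
  by apply: eq_bigr => k /eqP ->.
have := extreme_supp (k := f (Ordinal hi)) (vertex_extreme xX) lam0 lam1 (esym E).
suff lamp : 0 < lam (f (Ordinal hi)).
  by move=> /(_ lamp) h; have := fx (Ordinal hi); rewrite h eqxx.
rewrite /lam divr_gt0 // (bigD1 (Ordinal hi)) //=; apply: ltr_pwDl => //.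
exact: sumr_ge0.
Qed.

Let Hexp := vertex_exposed.

Section Face.
Variables c x : 'rV[R]_d.
Hypothesis xX : x \in X.
Hypothesis cx : maxat X c x.

Lemma face_in_face z : in_face X c x z -> face V c z.
Proof.
case/andP=> zX /eqP E; split; first exact: conv_vertices.
by apply/NC_maxat => y yX; rewrite E cx.
Qed.

Lemma face_dot y : face V c y -> dot c y = dot c x.
Proof. by case=> cy h; apply: NC_eq => //; [exact: conv_vertices | exact/NC_maxat]. Qed.

(** A segment of the polytope with an interior point in the face lies in the face, so extreme points
    of the face are extreme in the polytope. *)
Lemma face_extreme y : (y \in face_seq X c x) <-> extreme (face V c) y.
Proof.
rewrite in_face_seq; split=> [fy|[fy ey]].
  split=> [|a b t [fa _] [fb _]]; first exact: face_in_face.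
  have [_ h] := vertex_extreme (in_faceW fy); exact: h.
have exy : extreme (conv V) y.
  split; first by case: fy.
  move=> a b t ca cb t01 yE; apply: (ey a b t) => //.
    split=> //; apply/NCP => j.
    suff -> : dot c a = dot c y by case: fy => _ /NCP.
    have := congr1 (dot c) yE; rewrite dotDr !dotZr.
    have ha := fy.2 a ca; have hb := fy.2 b cb.
    move=> E; apply/eqP; rewrite eq_le ha /= leNgt; apply/negP => lt.
    case/andP: t01 => t0 t1.
    have : t * dot c a < t * dot c y by rewrite ltr_pM2l.
    have : (1 - t) * dot c b <= (1 - t) * dot c y by rewrite ler_pM2l ?subr_gt0.
    by lra.
  split=> //; apply/NCP => j.
  suff -> : dot c b = dot c y by case: fy => _ /NCP.
  have := congr1 (dot c) yE; rewrite dotDr !dotZr.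
  have ha := fy.2 a ca; have hb := fy.2 b cb.
  move=> E; apply/eqP; rewrite eq_le hb /= leNgt; apply/negP => lt.
  case/andP: t01 => t0 t1.
  have : t * dot c a <= t * dot c y by rewrite ler_pM2l.
  have : (1 - t) * dot c b < (1 - t) * dot c y by rewrite ltr_pM2l ?subr_gt0.
  by lra.
have [i yi] := extreme_row exy.
by rewrite /in_face face_dot // eqxx andbT yi.
Qed.

Lemma face_sub_span y (U : {vspace 'rV[R]_d}) : face V c y ->
  (forall z, in_face X c x z -> z - x \in U) -> y - x \in U.
Proof.
move=> [[l [l0 [l1 ->]]] /(NC_conv c l0 l1) h] hU.
have -> : \sum_i l i *: row i V - x = \sum_i l i *: (row i V - x).
  by rewrite -{1}[x]scale1r -l1 scaler_suml -sumrB; apply: eq_bigr => i _; rewrite scalerBr.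
apply: memv_suml => i _.
have := l0 i; rewrite le_eqVlt => /orP[/eqP <-|li]; first by rewrite scale0r mem0v.
apply/memvZ/hU; rewrite /in_face row_vertices; apply/eqP/face_dot.
by split; [exact: conv_row | exact: h].
Qed.

Local Notation fdiff := (fun u => exists a b, face V c a /\ face V c b /\ u = a - b).

Lemma span2P (a b v : 'rV[R]_d) : reflect (in_span a b v) (v \in <<[:: a; b]>>%VS).
Proof.
rewrite span_cons span_seq1; apply: (iffP memv_addP).
  by move=> [? /vlineP[k ->] [? /vlineP[k' ->] ->]]; exists k, k'.
move=> [k [k' ->]]; exists (k *: a); first by rewrite memvZ ?memv_line.
by exists (k' *: b) => //; rewrite memvZ ?memv_line.
Qed.

Lemma fdiff_sub (U : {vspace 'rV[R]_d}) : (forall z, in_face X c x z -> z - x \in U) ->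
  forall u, fdiff u -> u \in U.
Proof.
move=> hU u [a [b [fa [fb ->]]]].
have -> : a - b = (a - x) - (b - x) by rewrite opprB addrA subrK.
by apply: memvB; apply: face_sub_span.
Qed.

Lemma two_face_affdim : two_face X c x -> affdim (face V c) 2.
Proof.
case=> _ _ [e1 [e2 pl]] [y [z [fy fz yx ind]]].
have fx := in_face_refl c xX.
pose U : {vspace 'rV[R]_d} := <<[:: y - x; z - x]>>%VS.
have fr : free [:: z - x; y - x].
  rewrite free_cons span_seq1 seq1_free subr_eq0 yx andbT.
  by apply/vlineP => -[k E]; case: (ind k).
have dU : \dim U = 2%N by rewrite /U (eq_span (Y := [:: z - x;
  y - x])) ?(eqnP fr) // => w; rewrite !inE orbC.
have UE : U = <<[:: e1; e2]>>%VS.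
  apply/eqP; rewrite eqEdim dU; apply/andP; split.
    apply/span_subvP => w; rewrite !inE => /orP[] /eqP ->; apply/span2P; exact: pl.
  exact: leq_trans (dim_span _) _.
rewrite /affdim -dU; apply: dimset_of_span.
  by apply: fdiff_sub => w fw; rewrite UE; apply/span2P; apply: pl.
move=> U' hU'; apply/span_subvP => w; rewrite !inE => /orP[] /eqP ->; apply: hU';
  by [exists y, x; split; last split; last by []; apply: face_in_face
     |exists z, x; split; last split; last by []; apply: face_in_face].
Qed.

Lemma affdim_two_face : affdim (face V c) 2 -> two_face X c x.
Proof.
move=> ad; have fx := in_face_refl c xX.
have [U [dU SU Umin]] := dimset_span ad.
have small (W : {vspace 'rV[R]_d}) : (forall z, in_face X c x z -> z - x \in W) ->
  (2 <= \dim W)%N.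
  by move=> h; rewrite -dU; apply: dimvS; apply: Umin; apply: fdiff_sub.
split=> //.
  case: ad => [[Y [YS [fY sY]]] _].
  case: Y YS fY sY => [|e1 [|e2 [|]]] // YS fY _; exists e1, e2 => z z' fz fz'.
  apply/span2P.
  have -> : <<[:: e1; e2]>>%VS = U.
    apply/eqP; rewrite eqEdim dU (eqnP fY) andbT.
    by apply/span_subvP => w /YS; apply: SU.
  apply: SU; exists z, z'; split; first exact: face_in_face.
  by split; first exact: face_in_face.
have [y fy yx] : exists2 y, in_face X c x y & y != x.
  case: (classic (exists2 y, in_face X c x y & y != x)) => // h; exfalso.
  have := small 0%VS; rewrite dimv0 => H; suff: false by []. apply: H => z fz.
  rewrite memv0 subr_eq0; apply/contraT => zx; exfalso; apply: h; by exists z.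
case: (classic (exists2 z, in_face X c x z & forall k, z - x <> k *: (y - x))).
  by case=> z fz hz; exists y, z.
move=> h; exfalso.
have := small <[y - x]>%VS; rewrite dim_vline subr_eq0 yx => H.
suff: false by []. apply: H => z fz.
apply/contraT => zn; exfalso; apply: h; exists z => // k E.
by move: zn; rewrite E memvZ // memv_line.
Qed.

End Face.

Lemma evenP : even_polytope V <->
  (forall c x, two_face X c x -> ~~ odd (size (face_seq X c x))).
Proof.
split=> [ev c x tf|ev c ad s us hs].
  have [xX cx _ _] := tf.
  apply: (ev c) => //; first exact: (two_face_affdim xX cx).
    by rewrite filter_uniq ?undup_uniq.
  by move=> y; apply: face_extreme.
have [y fy] : exists y, face V c y.
  case: ad => [[[|u Y] [YS [_ sY]]] _] //.
  by have [y [? [fy _]]] := YS u (mem_head _ _); exists y.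
have [x xX cx] : exists2 x, x \in X & maxat X c x.
  case: fy => -[l [l0 [l1 ->]]] /(NC_conv c l0 l1) h.
  have [k lk] := conv_supp l0 l1.
  by exists (row k V) => //; apply/NC_maxat; apply: h.
have tf := affdim_two_face xX cx ad.
have -> : size s = size (face_seq X c x); last exact: ev.
apply: perm_size; apply: uniq_perm => //; first by rewrite filter_uniq ?undup_uniq.
by move=> z; apply/idP/idP => [/hs /face_extreme|/face_extreme /hs]; apply.
Qed.

End Polytope.

Section Stack.
Variables (R : realFieldType) (n d : nat).

Definition stackmx (T : 'I_n -> 'M[R]_d) (v : 'rV[R]_d) : 'M[R]_(n, d) :=
  \matrix_i (v *m T i).

Lemma row_stackmx T v i : row i (stackmx T v) = v *m T i.
Proof. by rewrite rowK. Qed.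

Lemma stackmx_is_linear T : linear (stackmx T).
Proof.
move=> a u v; apply/row_matrixP => i.
by rewrite [RHS]linearD [X in _ = X + _]linearZ /= !row_stackmx mulmxDl scalemxAl.
Qed.

HB.instance Definition _ T := GRing.isLinear.Build R 'rV[R]_d 'M[R]_(n, d) _
  (stackmx T) (stackmx_is_linear T).

End Stack.

(** * Regions and walks in the dual graph *)

Section Regions.
Variables (R : realFieldType) (d n : nat) (V : 'M[R]_(n, d)).
Hypothesis Vvert : forall i, extreme (conv V) (row i V).
Local Notation X := (vertices V).
Local Notation edge := (edge X).
Implicit Types (c u v x y z : 'rV[R]_d) (C : 'rV[R]_d -> Prop).

Let Hexp := vertex_exposed Vvert.

Lemma small_maxat (Y : seq 'rV[R]_d) c b x :
  (forall z, z \in Y -> dot c z < dot c x) ->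
  exists2 e, 0 < e & forall z, z \in Y -> dot (c + e *: b) z <= dot (c + e *: b) x.
Proof.
move=> h; have [z zY|e e0 he] := @small_pos R _ Y (fun z => dot c x - dot c z)
  (fun z => dot b x - dot b z); first by rewrite subr_gt0 h.
by exists e => // z /he; rewrite !dotE; lra.
Qed.

(** Around an exposing functional the cone contains a small step in every direction [b], so its span
    contains [b]. *)
Lemma NC_dim x : x \in X -> dimset (NC V x) d.
Proof.
move=> xX; have [c hc] := Hexp xX.
rewrite -[d in dimset _ d](@dim_rV R); apply: dimset_of_span; first by move=> s _;
  rewrite memvf.
move=> U' hU; apply/subvP => b _.
have [z|e e0 he] := @small_maxat [seq z <- X | z != x] c b x.
  by rewrite mem_filter => /andP[zx zX]; apply: hc.
have c1 : c \in U'.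
  apply/hU/NC_maxat => z zX; have [-> //|zx] := eqVneq z x; by rewrite ltW // hc.
have c2 : c + e *: b \in U'.
  apply/hU/NC_maxat => z zX; have [-> //|zx] := eqVneq z x.
  by apply: he; rewrite mem_filter zx.
have -> : b = e^-1 *: ((c + e *: b) - c).
  by rewrite addrC addKr scalerA mulVf ?scale1r // gt_eqF.
by rewrite memvZ // memvB.
Qed.

Lemma NC_inj x y : x \in X -> y \in X -> (forall c, NC V x c -> NC V y c) -> x = y.
Proof.
move=> xX yX h; have [c hc] := Hexp xX; apply/eqP/contraT => xy.
have /h/NC_maxat/(_ _ xX) : NC V x c.
  by apply/NC_maxat => z zX; have [-> //|zx] := eqVneq z x; rewrite ltW // hc.
by rewrite leNgt hc // eq_sym.
Qed.

Lemma region_NC x : x \in X -> region V (NC V x).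
Proof. by move=> xX; split; [exists x; split=> //;
  exact: conv_vertices | exact: NC_dim]. Qed.

(** Every functional of the cone is equally maximal at [y] and at a vertex in its support; as the
    cone spans the space, the two points coincide. *)
Lemma region_vertex C : region V C -> exists2 x, x \in X & forall c, C c <-> NC V x c.
Proof.
case=> -[y [[l [l0 [l1 yE]]] hC]] Cd; have [k lk] := conv_supp l0 l1.
have cy : conv V y by exists l.
suff E : y = row k V by exists (row k V); rewrite ?row_vertices // -E.
apply/eqP; rewrite -subr_eq0; apply/eqP/(dimset_full_orth Cd) => c /hC cC.
rewrite dotBr; apply/eqP; rewrite subr_eq0; apply/eqP/(NC_eq _ _ cC) => //.
  exact: conv_row.
by move: cC; rewrite yE => /(NC_conv V c l0 l1); apply.
Qed.

Lemma edge_dim x y : edge x y -> dimset (fun c => NC V x c /\ NC V y c) d.-1.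
Proof.
case/edgeP=> xX yX xy [c [cxy hc]].
have r0 : x - y != 0 by rewrite subr_eq0.
rewrite -(dim_orthv r0); apply: dimset_of_span => [s [sx sy]|U' hU].
  rewrite mem_orthv dotBr subr_eq0; apply/eqP/(NC_eq _ _ sx sy); exact: conv_vertices.
apply/subvP => b; rewrite mem_orthv dotBr subr_eq0 => /eqP bxy.
have [z|e e0 he] := @small_maxat [seq z <- X | (z != x) && (z != y)] c b x.
  by rewrite mem_filter => /andP[/andP[zx zy] zX]; apply: hc.
have key f : dot f x = dot f y -> (forall z, z \in X -> z != x -> z != y ->
  dot f z <= dot f x) ->
  NC V x f /\ NC V y f.
  move=> fxy hf; have fm : maxat X f x.
    move=> z zX; have [-> //|zx] := eqVneq z x; have [->|zy] := eqVneq z y;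
      first by rewrite fxy.
    exact: hf.
  by split; apply/NC_maxat => // z zX; rewrite -fxy fm.
have c1 : c \in U' by apply/hU/key => // z zX zx zy; rewrite ltW // hc.
have c2 : c + e *: b \in U'.
  apply/hU/key => [|z zX zx zy]; first by rewrite !dotDl !dotZl cxy bxy.
  by apply: he; rewrite mem_filter zx zy.
have -> : b = e^-1 *: ((c + e *: b) - c).
  by rewrite addrC addKr scalerA mulVf ?scale1r // gt_eqF.
by rewrite memvZ // memvB.
Qed.

Lemma edge_adjacent x y : edge x y -> adjacent V (NC V x) (NC V y).
Proof.
move=> xy; have [xX yX] := edgeX xy.
by split; [exact: region_NC|split; [exact: region_NC|exact: edge_dim]].
Qed.

Lemma edge_orth x y c : x \in X -> y \in X -> NC V x c -> NC V y c -> dot c (x - y) = 0.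
Proof.
move=> xX yX cx cy; rewrite dotBr; apply/eqP; rewrite subr_eq0; apply/eqP.
by apply: (NC_eq _ _ cx cy); apply: conv_vertices.
Qed.

Lemma refl_edge x y C C' v : edge x y -> (forall c, C c <-> NC V x c) ->
  (forall c, C' c <-> NC V y c) ->
  refl (fun c => C c /\ C' c) v = v *m reflmx (x - y).
Proof.
move=> xy hC hC'; have /edgeP[xX yX nxy _] := xy.
apply: refl_reflmx; first by rewrite subr_eq0.
  by move=> c [/hC cx /hC' cy]; apply: edge_orth.
apply: dimset_ext (edge_dim xy) => c.
by split=> -[/hC ? /hC' ?]; split.
Qed.

Hypothesis d0 : (0 < d)%N.

(** For each other vertex [z] some functional in both cones is smaller at [z]; otherwise [z - x]
    would be normal to the wall and [x], [y], [z] collinear. Summing these functionals exposes the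
    edge. *)
Lemma adjacent_edge x C C' : x \in X -> (forall c, C c <-> NC V x c) ->
  adjacent V C C' -> exists2 y, edge x y & forall c, C' c <-> NC V y c.
Proof.
move=> xX hC [_ [/region_vertex[y yX hC'] dS]]; exists y => //.
have {dS} dS : dimset (fun c => NC V x c /\ NC V y c) d.-1.
  by apply: dimset_ext dS => c; split=> -[/hC ? /hC' ?]; split.
have nxy : x != y.
  (* Here [0 < d] enters: for [d = 0] the predecessor is [d] itself and a region would be adjacent
     to itself. *)
  apply/eqP => E; have E' : d.-1 = d.
    apply: (dimset_uniq dS); apply: dimset_ext (NC_dim xX) => c.
    by rewrite -E; split=> [|[]].
  by have := prednK d0; rewrite E' => /eqP; rewrite eqn_leq ltnn.
apply/edgeP; split=> //.
pose S c := NC V x c /\ NC V y c.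
suff [c [Sc hc]] : exists c, S c /\ forall z, z \in [seq z <- X | (z != x) && (z != y)] ->
    dot c z < dot c x.
  exists c; split=> [|z zX zx zy]; last by apply: hc; rewrite mem_filter zx zy.
  by case: Sc => cx cy; apply: (NC_eq _ _ cx cy); apply: conv_vertices.
have ex z : z \in X -> z != x -> z != y -> exists2 c, S c & dot c z < dot c x.
  move=> zX zx zy; case: (classic (exists2 c, S c & dot c z < dot c x)) => // h; exfalso.
  have [|s [sx sy]||k E] := dimset_hyperplane (r := x - y) (u := z - x) _ _ dS.
  - by rewrite subr_eq0.
  - exact: edge_orth.
  - move=> s Ss; rewrite dotBr; apply/eqP; rewrite subr_eq0 eq_le.
    have [sx _] := Ss; have /NC_maxat/(_ _ zX) -> := sx.
    by rewrite leNgt; apply/negP => lt; apply: h; exists s.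
  apply: (@not_collinear R d X Hexp x z y (- k)) => //; rewrite 1?eq_sym //.
  by rewrite E scaleNr -scalerN opprB.
have sub : {subset [seq z <- X | (z != x) && (z != y)] <= X} by move=> z;
  rewrite mem_filter => /andP[].
have ne z : z \in [seq z <- X | (z != x) && (z != y)] -> z != x /\ z != y.
  by rewrite mem_filter => /andP[/andP[]].
elim: [seq z <- X | _] sub ne => [|a s ih] sub ne.
  by exists 0; split=> //; split; apply/NC_maxat => z _; rewrite !dot0l.
have [||c [[cx cy] hc]] := ih.
- by move=> z zs; apply: sub; rewrite inE zs orbT.
- by move=> z zs; apply: ne; rewrite inE zs orbT.
have [ax ay] := ne a (mem_head _ _); have aX := sub a (mem_head _ _).
have [b [bx by_] hb] := ex a aX ax ay.
move/NC_maxat: cx => cx; move/NC_maxat: cy => cy.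
move/NC_maxat: bx => bx; move/NC_maxat: by_ => by_.
exists (c + b); split.
  by split; apply/NC_maxat => z zX; rewrite !dotDl lerD // ?cx ?cy ?bx ?by_.
move=> z; rewrite inE !dotDl => /orP[/eqP ->|zs]; first by rewrite ler_ltD ?cx.
by rewrite ltr_leD ?hc // bx // sub // inE zs orbT.
Qed.

Lemma walk_path C0 w x : x \in X -> (forall c, C0 c <-> NC V x c) -> is_walk V C0 w ->
  exists p, [/\ path edge x p, forall c, last C0 w c <-> NC V (last x p) c
    & forall v, tW C0 w v = v *m walk_mx x p].
Proof.
elim: w C0 x => [|C w ih] C0 x xX hC0 /=.
  by exists [::]; split=> // v; rewrite mulmx1.
case=> adj ww; have [y xy hC] := adjacent_edge xX hC0 adj.
have [p [pp lp tp_]] := ih C y (edgeX xy).2 hC ww.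
exists (y :: p); split=> //=; first by rewrite xy.
by move=> v; rewrite tp_ (refl_edge _ xy hC0 hC) mulmxA.
Qed.

Lemma path_walk x p : path edge x p ->
  is_walk V (NC V x) (map (NC V) p) /\
  forall v, tW (NC V x) (map (NC V) p) v = v *m walk_mx x p.
Proof.
elim: p x => [|y p ih] x /=; first by split=> // v; rewrite mulmx1.
case/andP=> xy /ih[ww tp_]; split; first by split=> //; exact: edge_adjacent.
by move=> v; rewrite tp_ (refl_edge _ xy) // mulmxA.
Qed.

Definition trivial_monodromy := forall x p, path edge x p -> x \in X -> last x p = x ->
  walk_mx x p = 1%:M.

Lemma InSpcP : trivial_monodromy <-> (forall C0, region V C0 -> forall v, InSpc V C0 v).
Proof.
split=> [tm C0 rC0 v w ww lw|h x p pp xX lx].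
  have [x xX hx] := region_vertex rC0.
  have [p [pp lp ->]] := walk_path xX hx ww.
  have lX : last x p \in X.
    have := mem_last x p; rewrite inE => /orP[/eqP ->|] //.
    by case/(path_pred pp) => a _ /edgeX[].
  rewrite tm ?mulmx1 //; apply: NC_inj => // c.
  by move/lp/lw/hx.
have [ww E] := path_walk pp.
apply/row_matrixP => i; rewrite !rowE -E mulmx1.
by apply: (h _ (region_NC xX)) => // c; rewrite last_map lx.
Qed.

Lemma generic_functional : exists l, {in X &, injective (dot l)}.
Proof.
have [||u k|l [_ _ hl]] := @generic_perturb R d 0 0 [::]
   [seq p <- allpairs (fun a b => a - b) X X | p != 0] => //.
- by rewrite dot0l.
- by rewrite mem_filter scaler0 => /andP[/eqP].
exists l => x y xX yX E; apply/eqP/contraT => xy.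
have := hl (x - y); rewrite dotBr E subrr eqxx mem_filter subr_eq0 xy => h.
suff: false by []. apply: h; apply/allpairsP; by exists (x, y).
Qed.

Hypothesis Pfull : full_dim V.

Lemma orth_vertices u x0 : x0 \in X -> (forall x, x \in X -> dot u x = dot u x0) -> u = 0.
Proof.
move=> x0X h; apply: (dimset_full_orth Pfull) => s [x [y [cx [cy ->]]]].
have cst z : conv V z -> dot u z = dot u x0.
  move=> [l [l0 [l1 ->]]]; rewrite dot_sumr -[RHS]mul1r -l1 mulr_suml.
  by apply: eq_bigr => i _; rewrite dotZr h ?row_vertices.
by rewrite dotC dotBr !cst // subrr.
Qed.

Lemma vertices_nonempty : exists x0, x0 \in X.
Proof.
have [[Y [YS [fY sY]]] _] := Pfull.
case: Y YS fY sY => [|u Y] YS _ sY; first by exfalso; move: d0; rewrite -sY.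
have [x [y [[l [l0 [l1 _]]] _]]] := YS u (mem_head _ _).
by have [k _] := conv_supp l0 l1; exists (row k V); apply: row_vertices.
Qed.

Lemma expose_path c x y : exposes X c x -> x \in X -> y \in X ->
  exists2 p, path (up edge (dot c)) y p & last y p = x.
Proof.
move=> hc xX yX; have [|||p [pp [lX lm]]] := @ascend R _ X edge (dot c) _ _ _ y yX.
- by move=> a b /edge_sym.
- by move=> a b /edgeX[].
- move=> a b aX bX lab; have [e ae le] := simplex Hexp aX bX lab.
  by exists e; rewrite /up ae.
exists p => //; apply/eqP/contraT => nx.
by have := hc _ lX nx; rewrite ltNge lm.
Qed.

Lemma connected x y : x \in X -> y \in X -> exists p, path edge x p /\ last x p = y.
Proof.
move=> xX yX; have [c hc] := Hexp yX; have [p pp lp] := expose_path hc yX xX.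
by exists p; split=> //; apply: sub_path pp => a b /andP[].
Qed.

Section Realize.
Variables (m : nat) (W : 'M[R]_(m, d)).
Hypothesis Wins : inscribed W.
Hypothesis Wfan : same_fan V W.

(** Equal fans match vertices through their normal cones and make corresponding edges parallel. Both
    ends of an edge lie on a sphere about [z], so the reflection along the edge direction, centered
    at [z], swaps them. *)
Lemma realization : exists (w : 'rV[R]_d -> 'rV[R]_d) (z : 'rV[R]_d),
  [/\ forall x y, edge x y -> w x *m reflmx (x - y) = w y,
      forall x y, edge x y -> exists2 k, 0 < k & w y - w x = k *: (y - x)
    & forall x y, x \in X -> conv W y -> (forall c, NC W y c <-> NC V x c) -> y - z = w x].
Proof.
have [z [rho hrho]] := Wins.
pose Q x y := conv W y /\ forall c, NC W y c <-> NC V x c.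
pose q x := epsilon (inhabits 0) (Q x).
have qP x : x \in X -> Q x (q x).
  move=> xX; apply: epsilon_spec.
  have /Wfan[y [cy hy]] : fan V (NC V x) by exists x; split=> //; exact: conv_vertices.
  by exists y; split=> // c; rewrite hy.
have quniq x y : x \in X -> Q x y -> y = q x.
  move=> xX [cy hy]; have [cq hq] := qP x xX.
  apply/eqP; rewrite -subr_eq0; apply/eqP/(dimset_full_orth (NC_dim xX)) => c cx.
  rewrite dotBr; apply/eqP; rewrite subr_eq0; apply/eqP; apply: (@NC_eq _ _ _ W) => //;
    first exact/hy.
  exact/hq.
have qext x : x \in X -> extreme (conv W) (q x).
  move=> xX; have [cq hq] := qP x xX; split=> // a b t ca cb /andP[t0 t1] E.
  apply/eqP; rewrite -subr_eq0; apply/eqP/(dimset_full_orth (NC_dim xX)) => c /hq cx.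
  have := congr1 (dot c) E; rewrite dotDr !dotZr dotBr.
  have ha := cx a ca; have hb := cx b cb => e.
  have h1 : t * dot c a <= t * dot c (q x) by rewrite ler_pM2l.
  have h2 : (1 - t) * dot c b <= (1 - t) * dot c (q x) by rewrite ler_pM2l ?subr_gt0.
  have e1 : t * dot c a = t * dot c (q x) by lra.
  have e2 : (1 - t) * dot c b = (1 - t) * dot c (q x) by lra.
  have t0' : t != 0 by rewrite gt_eqF.
  have t1' : 1 - t != 0 by rewrite subr_eq0 gt_eqF.
  by rewrite (mulfI t0' e1) (mulfI t1' e2) subrr.
have qedge x y : edge x y -> exists2 k, 0 < k & q y - q x = k *: (y - x).
  move=> xy; have /edgeP[xX yX nxy _] := xy.
  have [cqx hqx] := qP x xX; have [cqy hqy] := qP y yX.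
  have [||s [sx sy]|k E] := dimset_hyperplane (r := y - x) (u :=
    q y - q x) _ _ (edge_dim xy).
  - by rewrite subr_eq0 eq_sym.
  - by move=> s [sx sy]; apply: edge_orth.
  - by rewrite dotBr; apply/eqP; rewrite subr_eq0; apply/eqP;
    apply: (@NC_eq _ _ _ W) => //; [exact/hqy|exact/hqx].
  exists k => //; have [c hc] := Hexp xX.
  have cx : NC V x c.
    by apply/NC_maxat => v vX; have [-> //|vx] := eqVneq v x; rewrite ltW // hc.
  have k0 : k != 0.
    apply/eqP => k0; move: nxy => /eqP; apply; apply: NC_inj => // c' /hqx c'x.
    apply/hqy; suff -> : q y = q x by [].
    by apply/eqP; rewrite -subr_eq0 E k0 scale0r.
  rewrite lt_neqAle eq_sym k0 /=; have /hqx/(_ _ cqy) := cx.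
  have := congr1 (dot c) E; rewrite dotZr !dotBr => e le.
  have lt : dot c y - dot c x < 0 by rewrite subr_lt0 hc // eq_sym.
  have : k * (dot c y - dot c x) <= 0 by rewrite -e subr_le0.
  by rewrite nmulr_lle0.
have wedge x y : edge x y -> (q x - z) *m reflmx (x - y) = q y - z.
  move=> xy; have [k k0 E] := qedge x y xy; have /edgeP[xX yX nxy _] := xy.
  have qyE : q y - z = (q x - z) + k *: (y - x) by rewrite -E [RHS]addrC addrA subrK.
  have := hrho _ (qext y yX); rewrite -(hrho _ (qext x xX)) qyE.
  move: (q x - z) => a; set r := y - x.
  have r0 : 0 < dot r r by rewrite dot_gt0 // subr_eq0 eq_sym.
  rewrite !dotDl !dotDr !dotZl !dotZr (dotC r a) => e.
  (* Equality of the squared distances; as [k] is nonzero, it must be the coefficient of the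
     reflection. *)
  have e' : k * (2 * dot a r + k * dot r r) = 0 by lra.
  move/eqP: e'; rewrite mulf_eq0 (gt_eqF k0) /= => /eqP e'.
  have -> : k = - (2 * dot a r / dot r r).
    by apply: (mulIf (negbT (gt_eqF r0))); rewrite mulNr divfK ?gt_eqF //; lra.
  by rewrite reflmx_sym mul_reflmx scaleNr.
exists (fun x => q x - z), z; split=> //.
  move=> x y /qedge[k k0 E]; exists k => //.
  by rewrite -E opprB addrA subrK.
by move=> x y xX cy hy; rewrite (quniq x y xX).
Qed.

End Realize.
End Regions.

(** * The inscribed cone *)

Section Cone.
Variables (R : realFieldType) (d n : nat) (V : 'M[R]_(n, d)).
Hypothesis Vvert : forall i, extreme (conv V) (row i V).
Local Notation X := (vertices V).
Local Notation edge := (edge X).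
Implicit Types (c u v x y z : 'rV[R]_d) (M : 'M[R]_(n, d)).

Let Hexp := vertex_exposed Vvert.

Hypothesis Pfull : full_dim V.
Variable x0 : 'rV[R]_d.
Hypothesis x0X : x0 \in X.

(** An arbitrary path from [x0] is chosen; under trivial monodromy, [transport_path] shows that the
    choice is immaterial. *)
Definition transport x := walk_mx x0 (epsilon (inhabits [::])
  (fun p => path edge x0 p /\ last x0 p = x)).

Lemma transportP x : x \in X ->
  exists p, [/\ path edge x0 p, last x0 p = x & transport x = walk_mx x0 p].
Proof.
move=> xX; have [h1 h2] := epsilon_spec (inhabits [::]) _ (connected Vvert x0X xX).
by eexists; split; [exact: h1|exact: h2|].
Qed.

Definition spread := stackmx (fun i => transport (row i V)).
Definition translations := stackmx (fun _ : 'I_n => 1%:M : 'M[R]_d).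

Lemma row_spread v i : row i (spread v) = v *m transport (row i V).
Proof. exact: row_stackmx. Qed.

Lemma row_translations v i : row i (translations v) = v.
Proof. by rewrite row_stackmx mulmx1. Qed.

Lemma transl_mxP M : transl_mx M <-> M \in limg (linfun translations).
Proof.
split=> [[t ht]|/memv_imgP[t _ ->]].
  apply/memv_imgP; exists t; rewrite ?memvf // lfunE.
  by apply/row_matrixP => i; rewrite ht row_translations.
by exists t => i; rewrite lfunE row_translations.
Qed.

Lemma dim_translations : \dim (limg (linfun translations)) = d.
Proof.
rewrite limg_dim_eq ?dim_rV // capfv; apply/eqP; rewrite -subv0.
apply/subvP => v; rewrite memv_ker lfunE memv0 => /eqP e.
have [i _] := verticesP _ _ x0X; have e' : translations v = 0 := e.
by rewrite -(row_translations v i) e' linear0.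
Qed.

Lemma dimset_transl b : dimset (@transl_mx R d n) b -> b = d.
Proof.
move=> hb; apply: (dimset_uniq hb); rewrite -[X in dimset _ X]dim_translations.
apply: dimset_of_span => [M /transl_mxP //|U' hU].
by apply/subvP => M /transl_mxP; apply: hU.
Qed.

Lemma InCone_decomp M : InCone_mx V M -> exists u z,
  (forall p, path edge x0 p -> last x0 p = x0 -> u *m walk_mx x0 p = u) /\
  M = spread u + translations z.
Proof.
case=> Mins [Mfan hM]; have [w [z [we _ wM]]] := realization Vvert Mins Mfan.
exists (w x0), z; split=> [p pp lp|]; first by rewrite (walk_mx_carry we pp) lp.
apply/row_matrixP => i; rewrite linearD /= row_spread row_translations.
have [p [pp lp ->]] := transportP (row_vertices V i).
rewrite (walk_mx_carry we pp) lp -(wM _ (row i M)) ?subrK //.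
- exact: row_vertices.
- exact: conv_row.
Qed.

(** Cone and translations lie in the translations plus the image of the space [F] fixed by the walk.
    Comparing dimensions, [d + d <= d + \dim F], so the walk fixes everything. *)
Lemma dim_InCone_fixed p : (0 < d)%N -> dim_InCone V d ->
  path edge x0 p -> last x0 p = x0 -> walk_mx x0 p = 1%:M.
Proof.
move=> d0 [a [b [ha [/dimset_transl -> abd]]]] pp lp.
(* Since [d] is positive, the difference [a - d = d] is not a truncated subtraction. *)
have {abd} aE : a = (d + d)%N.
  have [le|lt] := leqP d a; first by rewrite -[X in (_ + X)%N]abd subnKC.
  by move: d0; rewrite lt0n -abd subn_eq0 ltnW.
pose F : {vspace 'rV[R]_d} := lker (linfun (mulmxr (walk_mx x0 p - 1%:M))).
pose U := (limg (linfun translations) + (linfun spread @: F))%VS.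
have aU : (a <= \dim U)%N.
  have [U2 [<- _ U2min]] := dimset_span ha; apply: dimvS; apply: U2min => M [hM|hM].
    have [u [z [uf ->]]] := InCone_decomp hM.
    rewrite addrC memv_add //; first by apply/transl_mxP; exists z => i;
      rewrite row_translations.
    apply/memv_imgP; exists u; last by rewrite lfunE.
    by rewrite memv_ker lfunE /= mulmxBr mulmx1 uf // subrr.
  by rewrite -[M]addr0 memv_add ?mem0v //; apply/transl_mxP.
have leF : (\dim (linfun spread @: F) <= \dim F)%N.
  by rewrite -(limg_ker_dim (linfun spread) F) leq_addl.
have dF : (d <= \dim F)%N.
  rewrite -(leq_add2l d) -aE (leq_trans aU) //.
  apply: leq_trans (dimv_add_leqif _ _) _.
  by rewrite dim_translations leq_add2l.
have FE : F = fullv by apply/eqP; rewrite eqEdim subvf dim_rV.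
apply/row_matrixP => i; rewrite !rowE.
have : delta_mx 0 i \in F by rewrite FE memvf.
by rewrite memv_ker lfunE /= mulmxBr subr_eq0 => /eqP.
Qed.

Section Trivial.
Hypothesis tm : trivial_monodromy V.

Lemma transport_path p : path edge x0 p -> transport (last x0 p) = walk_mx x0 p.
Proof.
move=> pp; have lX : last x0 p \in X.
  have := mem_last x0 p; rewrite inE => /orP[/eqP ->|] //.
  by case/(path_pred pp) => a _ /edgeX[].
have [q [qq lq ->]] := transportP lX.
exact: (walk_mx_same_end tm qq pp x0X lq).
Qed.

Lemma transport0 : transport x0 = 1%:M.
Proof. exact: (@transport_path [::]). Qed.

Lemma transport_edge x y : edge x y -> transport y = transport x *m reflmx (x - y).
Proof.
move=> xy; have [p [pp lp ->]] := transportP (edgeX xy).1.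
have := @transport_path (rcons p y); rewrite last_rcons rcons_path pp lp xy => -> //.
by rewrite -cats1 walk_mx_cat lp /= mulmx1.
Qed.

Lemma dot_transport u v x : x \in X -> dot (u *m transport x) (v *m transport x) = dot u v.
Proof. by move=> /transportP[p [_ _ ->]]; rewrite dot_walk_mx. Qed.

(** Up to a positive factor, the quantity is the signed length of the edge of [spread v] in
    direction [y - x]. *)
Definition positive v := forall x y, edge x y -> 0 < dot (v *m transport x) (x - y).

Lemma positive_edge v x y : positive v -> edge x y ->
  exists2 k, 0 < k & v *m transport y - v *m transport x = k *: (y - x).
Proof.
move=> pv xy; exists (2 * dot (v *m transport x) (x - y) / dot (x - y) (x - y)).
  rewrite divr_gt0 ?mulr_gt0 ?pv // dot_gt0 // subr_eq0.
  by case/edgeP: xy.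
by rewrite (transport_edge xy) mulmxA mul_reflmx addrAC subrr add0r -scalerN opprB.
Qed.

Lemma positive_increasing v c x p : positive v -> path (up edge (dot c)) x p ->
  dot c (v *m transport x) <= dot c (v *m transport (last x p)).
Proof.
move=> pv; elim: p x => //= y p ih x /andP[/andP[xy lxy] /ih]; apply: le_trans.
have [k k0 E] := positive_edge pv xy.
by rewrite -subr_ge0 -dotBr E dotZr mulr_ge0 ?ltW // dotBr subr_gt0.
Qed.

(** Corresponding edges are positive multiples of each other, so an improving edge in [V] improves
    in [spread v], and ascents in [V] never decrease there. *)
Lemma positive_NC v i c : positive v ->
  NC (spread v) (row i (spread v)) c <-> NC V (row i V) c.
Proof.
move=> pv; split=> [/NCP h|h].
  apply/NC_maxat => z zX; rewrite leNgt; apply/negP => lt.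
  have [y xy ly] := simplex Hexp (row_vertices V i) zX lt.
  have [k k0 E] := positive_edge pv xy.
  have /verticesP[j yj] := (edgeX xy).2.
  have := h j; rewrite !row_spread -yj -subr_le0 -dotBr E dotZr leNgt.
  by rewrite mulr_gt0 // dotBr subr_gt0.
apply/NCP => j; rewrite !row_spread -subr_le0 -dotBr leNgt; apply/negP => lt.
set a := _ - _ in lt.
have [c0 hc0] := Hexp (row_vertices V i).
(* A violation survives a slight tilt of [c]; the tilted functional exposes row [i], so an ascent
   from row [j] to it gives a contradiction. *)
have [_ _|e e0 he] := @small_pos R _ [:: tt] (fun=> dot c a) (fun=> dot c0 a).
  by [].
have := he tt (mem_head _ _).
have ex : exposes X (c + e *: c0) (row i V).
  move=> z zX zx; rewrite !dotDl !dotZl; move/NC_maxat: h => h.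
  by rewrite ler_ltD ?h // ltr_pM2l // hc0.
have [p pp lp] := expose_path Vvert ex (row_vertices V i) (row_vertices V j).
have := positive_increasing pv pp; rewrite lp -subr_le0 -dotBr -/a.
by rewrite dotDl dotZl leNgt => /negP.
Qed.

Lemma positive_InCone v : positive v -> InCone_mx V (spread v).
Proof.
move=> pv; split; [|split].
- exists 0, (dot v v) => w /extreme_row[i ->].
  by rewrite row_spread subr0 dot_transport // row_vertices.
- have key l c : (forall i, 0 <= l i) -> \sum_i l i = 1 ->
    NC (spread v) (\sum_i l i *: row i (spread v)) c <-> NC V (\sum_i l i *: row i V) c.
    move=> l0 l1; split=> /(NC_conv _ c l0 l1) h; apply/(NC_conv _ c l0 l1) => k /h;
      by move/(positive_NC _ _ pv).
  move=> C; split=> -[x [[l [l0 [l1 xE]]] hC]].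
    exists (\sum_i l i *: row i (spread v)); split; first by exists l.
    by move=> c; split=> [/hC|h]; [rewrite xE => /key|apply/hC; rewrite xE; apply/key];
      auto.
  exists (\sum_i l i *: row i V); split; first by exists l.
  by move=> c; split=> [/hC|h]; [rewrite xE => /key|apply/hC; rewrite xE; apply/key]; auto.
by move=> i c; apply: positive_NC.
Qed.

Lemma positive_open v u : positive v -> exists2 e, 0 < e & positive (v + e *: u).
Proof.
move=> pv.
have [[x y]|e e0 he] := @small_pos R _ [seq p <- allpairs pair X X | edge p.1 p.2]
  (fun p => dot (v *m transport p.1) (p.1 - p.2))
  (fun p => dot (u *m transport p.1) (p.1 - p.2)).
  by rewrite mem_filter => /andP[/pv].
exists e => // x y xy; have := he (x, y).
rewrite mem_filter xy /= mulmxDl -scalemxAl dotDl dotZl; apply.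
by apply/allpairsP; exists (x, y); case/edgeX: xy.
Qed.

Lemma dim_InCone_full v0 : positive v0 -> dim_InCone V d.
Proof.
move=> pv0.
have [b hb] := dimset_exists (@transl_mx R d n).
pose U := (limg (linfun spread) + limg (linfun translations))%VS.
exists (\dim U), b; split; last split=> //.
- apply: dimset_of_span => [M [/InCone_decomp[u [z [_ ->]]]|/transl_mxP hM]|U' hU].
  + apply: memv_add; first by apply/memv_imgP; exists u; rewrite ?memvf ?lfunE.
    by apply/transl_mxP; exists z => i; rewrite row_translations.
  + by rewrite -[M]add0r memv_add ?mem0v.
  apply/subvP => M /memv_addP[_ /memv_imgP[u _ ->] [T hT ->]]; apply: memvD; last first.
    by apply: hU; right; apply/transl_mxP.
  (* Positivity is open, so every [u] is a scaled difference of two positive vectors. *)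
  have [e e0 pe] := positive_open u pv0.
  have h0 : spread v0 \in U' by apply: hU; left; apply: positive_InCone.
  have h1 : spread (v0 + e *: u) \in U' by apply: hU; left; apply: positive_InCone.
  have -> : linfun spread u = e^-1 *: (spread (v0 + e *: u) - spread v0).
    rewrite lfunE -linearB addrAC subrr add0r linearZ scalerA mulVf ?scale1r //.
    by rewrite gt_eqF.
  by rewrite memvZ // memvB.
rewrite (dimset_transl hb).
(* If all rows of [spread u] agree, every edge reflection fixes [u]; then [u] is orthogonal to all
   edges, hence constant on the vertices, hence zero by full dimension. *)
have inj : (limg (linfun spread) :&: limg (linfun translations))%VS = 0%VS /\
  (lker (linfun spread) = 0)%VS.
  have key u t : spread u = translations t -> u = 0.
    move=> E.
    have Ex x : x \in X -> u *m transport x = t.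
      by case/verticesP => i ->; rewrite -row_spread E row_translations.
    have ut : u = t by rewrite -(Ex _ x0X) transport0 mulmx1.
    apply: (orth_vertices Pfull x0X) => x xX.
    have [p [pp lp _]] := transportP xX.
    have : forall q y, path edge y q -> dot u (last y q) = dot u y.
      elim=> // y' q ih y /= /andP[yy' /ih ->].
      have := Ex _ (edgeX yy').2; rewrite (transport_edge yy') mulmxA (Ex _ (edgeX yy').1).
      rewrite mul_reflmx -[X in _ = X]subr0 => /addrI /oppr_inj /eqP.
      rewrite scaler_eq0 subr_eq0; case/edgeP: (yy') => _ _ nyy' _.
      rewrite (negbTE nyy') orbF !mulf_eq0 invr_eq0 dot_eq0 subr_eq0 (negbTE nyy') orbF.
      by rewrite pnatr_eq0 /= dotBr subr_eq0 ut => /eqP ->.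
    by move=> /(_ p x0 pp); rewrite lp.
  split; apply/eqP; rewrite -subv0; apply/subvP => M.
    rewrite memv_cap => /andP[/memv_imgP[u _ ->] /memv_imgP[t _]].
    by rewrite !lfunE => /key ->; rewrite linear0 mem0v.
  rewrite memv_ker lfunE memv0 => /eqP E; apply/eqP/(key M 0).
  by apply: (etrans E); rewrite /translations linear0.
rewrite dimv_disjoint_sum ?inj.1 // dim_translations addnK.
by rewrite limg_dim_eq ?dim_rV // capfv inj.2.
Qed.

End Trivial.
End Cone.

Theorem theorem4p14 (R : realFieldType) (d n : nat) (V : 'M[R]_(n, d))
  (Vvert : forall i, extreme (conv V) (row i V))
  (Pfull : full_dim V)
  (Hins : exists m (W : 'M[R]_(m, d)), inscribed W /\ same_fan V W) :
  [/\ (even_polytope V <-> dim_InCone V d),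
      (dim_InCone V d <-> (forall C0, region V C0 -> forall v, InSpc V C0 v)) &
      (even_polytope V <-> (forall C0, region V C0 -> forall v, InSpc V C0 v))].
Proof.
have [dz|d0] := posnP d.
  (* In dimension 0 all three properties hold outright: there are no 2-faces and all spaces involved
     are zero. *)
  move: dz V Vvert Pfull Hins => -> V Vvert Pfull Hins.
  have E : even_polytope V.
    move=> c [[Y [_ [fY sY]]] _].
    by have := free_size_le (U := fullv) fY (fun x _ => memvf x); rewrite sY dim_rV.
  have D : dim_InCone V 0.
    have [a ha] := dimset_exists (fun M => InCone_mx V M \/ transl_mx M).
    have [b hb] := dimset_exists (@transl_mx R 0 n).
    exists a, b; split=> //; split=> //.
    have [U [<- _ _]] := dimset_span ha.
    suff -> : \dim U = 0%N by [].
    by apply/eqP; rewrite -leqn0 (leq_trans (dimvS (subvf _))) // dimvf /dim /= muln0.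
  have S : forall C0, region V C0 -> forall v, InSpc V C0 v.
    by move=> C0 _ v w _ _; rewrite [LHS]thinmx0 [RHS]thinmx0.
  by split; split.
have h3 := InSpcP Vvert d0.
suff [h1 h2] : (even_polytope V <-> trivial_monodromy V) /\
    (dim_InCone V d <-> trivial_monodromy V) by split; rewrite ?h1 ?h2 ?h3.
have [m [W [Wins Wfan]]] := Hins.
have [w [z [we wk _]]] := realization Vvert Wins Wfan.
have [l l_inj] := generic_functional V.
split; split.
- move/(evenP Vvert) => ev x p pp xX lx.
  apply: (closed_path_trivial (vertex_exposed Vvert) l_inj we _ ev) => // a b ab.
  have [k k0 E] := wk a b ab; rewrite eq_sym -subr_eq0 E scaler_eq0 (gt_eqF k0) /=.
  by rewrite subr_eq0 eq_sym; case/edgeP: ab.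
- move=> tm; apply/(evenP Vvert) => c x tf.
  by refine (two_face_even (vertex_exposed Vvert) l_inj tm tf).
- by move=> hd x p pp xX lx; apply: (dim_InCone_fixed Vvert xX).
move=> tm; have [x0 x0X] := vertices_nonempty d0 Pfull.
(* The base vertex of the given inscribed polytope is a positive vector, because that polytope has
   positive edge lengths. *)
apply: (dim_InCone_full Vvert Pfull x0X tm (v0 := w x0)) => x y xy.
have [xX yX] := edgeX xy; have [k k0 E] := wk x y xy.
have [p [pp lp ->]] := transportP Vvert x0X xX.
rewrite (walk_mx_carry we pp) lp; move: E; rewrite -(we x y xy) mul_reflmx.
have nxy : x != y by case/edgeP: xy.
have r0 : 0 < dot (x - y) (x - y) by rewrite dot_gt0 // subr_eq0.
move/(congr1 (dot (x - y))); rewrite addrAC subrr add0r -(opprB x y) dotNr !dotZr dotNr mulrN.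
move/oppr_inj; rewrite divfK ?gt_eqF // => E.
by rewrite -(pmulr_rgt0 _ (ltr0n R 2)) E mulr_gt0.
Qed.
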